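(* Let $W$ be a finite Weyl group and fix a $2$-cocycle class $\alpha\in H^2(W,\mathbb C^* )$. There is an isomorphism of superalgebras $$\dot\Phi_-^{\alpha}:\ \mathcal C_{\mathfrak h^*}\rtimes_-\mathbb C W^{-\alpha}\ \xrightarrow{\ \simeq\ }\ \mathcal C_{\mathfrak h^*}\otimes\mathbb C W^{\alpha}$$ which extends the identity map on $\mathcal C_{\mathfrak h^*}$ and sends $t_i^-\mapsto\beta_it_i$ for each $i$. The inverse map $\dot\Psi_-^\alpha$ is the extension of the identity map on $\mathcal C_{\mathfrak h^*}$ which sends $t_i\mapsto\beta_it_i^-$ for each $i$.
   Context: All algebras are over $\mathbb C$. A superalgebra is a $\mathbb Z_2$-graded algebra; tensor products of superalgebras have multiplication $(a\otimes b)(a'\otimes b')=(-1)^{|b||a'|}aa'\otimes bb'$. $W$ is a finite Weyl group (irreducible) with simple reflections $s_1,\dots,s_n$ and relations $(s_is_j)^{m_{ij}}=1$. $\mathfrak h$ is the reflection representation (in type $A_{n-1}$ take $\mathfrak h=\mathbb C^n$, the Cartan subalgebra of $gl_n$), with the standard $W$-invariant nondegenerate symmetric bilinear form $(-,-)$ on $\mathfrak h^*$. $\mathcal C_{\mathfrak h^*}$ is the Clifford algebra generated by $\mathfrak h^*$ with $ab+ba=(a,b)$; $W$ acts on it by automorphisms $a\mapsto a^w$. $\beta_i\in\mathfrak h^*$ is the simple root $\alpha_i$ rescaled by a positive scalar so that $\beta_i^2=1$, i.e. $(\beta_i,\beta_i)=2$. One has $H^2(W,\mathbb C^* )\cong\mathbb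 Z_2^k$ for some $k\in\{0,1,2,3\}$ (Ihara–Yokonuma); write $\alpha=(\alpha_1,\dots,\alpha_k)\in\{\pm1\}^k$ and $-\alpha=(-\alpha_1,\dots,-\alpha_k)$. The algebra $\mathbb C W^\alpha$ is generated by $t_1,\dots,t_n$ subject to $(t_it_j)^{m_{ij}}=1$ if $m_{ij}\in\{1,3\}$, and $(t_it_j)^{m_{ij}}=\alpha_{ij}$ if $m_{ij}\in\{2,4,6\}$, where $\alpha_{ij}=\alpha_{ji}\in\{\pm1\}$ is given as follows. - $A_n$ ($n\ge3$), $E_6,E_7,E_8$: $k=1$, $\alpha_{ij}=\alpha_1$ whenever $m_{ij}=2$. - $B_2$: $k=1$, $\alpha_{12}=\alpha_1$. - $B_3$: $k=2$, $\alpha_{13}=\alpha_1$, $\alpha_{23}=\alpha_2$. - $B_n$ ($n\ge4$): $k=3$, $\alpha_{ij}=\alpha_1$ for $i<j\le n-1$ with $m_{ij}=2$; $\alpha_{in}=\alpha_2$ for $i\le n-2$; $\alpha_{n-1,n}=\alpha_3$. - $D_4$ (node $2$ is the trivalent node): $k=3$, $\alpha_{13}=\alpha_1$, $\alpha_{14}=\alpha_2$, $\alpha_{34}=\alpha_3$. - $D_n$ ($n\ge5$; nodes $n-1$ and $n$ are both joined to $n-2$): $k=2$, $\alpha_{ij}=\alpha_1$ for $i<j$, $m_{ij}=2$, $i\ne n-1$; $\alpha_{n-1,n}=\alpha_2$. - $F_4$: $k=2$, $\alpha_{ij}=\alpha_1$ whenever $m_{ij}=2$, $\alpha_{23}=\alpha_2$.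 - $G_2$: $k=1$, $\alpha_{12}=\alpha_1$. - $A_1,A_2$: $k=0$ and there are no even $m_{ij}$. This algebra is a twisted group algebra of $W$ of dimension $|W|$. $\mathcal C_{\mathfrak h^*}\rtimes_-\mathbb C W^{-\alpha}$ is the algebra generated by the subalgebras $\mathcal C_{\mathfrak h^*}$ and $\mathbb C W^{-\alpha}$ (as a vector space it is their tensor product), where the generators of $\mathbb C W^{-\alpha}$ are denoted $t_i^-$, with the additional relations $t_i^-a=-a^{s_i}t_i^-$ for all $i$ and $a\in\mathfrak h^*$. Gradings: elements of $\mathfrak h^*$ are odd, the $t_i^-$ are odd, and the $t_i\in\mathbb C W^\alpha$ are even. *)

(* Defs.v *)
From HB Require Import structures.
From mathcomp Require Import all_boot all_order all_algebra.
From mathcomp Require Import boolp generic_quotient.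

Set Implicit Arguments.
Unset Strict Implicit.
Unset Printing Implicit Defensive.

Import Order.TTheory GRing.Theory Num.Theory.
Local Open Scope ring_scope.

(* A K-algebra is given by its structure map algc : K -> A, a ring morphism
   with central image, and scaling by c is multiplication by algc c.
   MathComp's algType is not used because it excludes the zero ring, whereas
   an algebra given by generators and relations may a priori collapse.
   The grading A = A_0 (+) A_1 is given by the projections spart d onto A_d
   (d = true for odd), so x lies in A_d iff spart d x = x. *)
HB.mixin Record isSuperAlgebra (K : comPzRingType) A of GRing.PzRing A := {
  algc : K -> A;
  algc_is_zmod : zmod_morphism algc;
  algc_is_monoid : monoid_morphism algc;
  algcC : forall c x, algc c * x = x * algc c;
  spart : bool -> A -> A;
  spart_is_zmod : forall d, zmod_morphism (spart d);
  spart_algc : forall d c x, spart d (algc c * x) = algc c * spart d x;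
  spart_sum : forall x, spart false x + spart true x = x;
  spart_spart : forall d e x,
    spart d (spart e x) = if d == e then spart e x else 0;
  spart_mul : forall d e x y,
    spart (d (+) e) (spart d x * spart e y) = spart d x * spart e y
}.

#[short(type="superAlgType")]
HB.structure Definition SuperAlgebra (K : comPzRingType) :=
  {A of isSuperAlgebra K A & GRing.PzRing A}.

HB.instance Definition _ (K : comPzRingType) (A : superAlgType K) :=
  GRing.isZmodMorphism.Build K A (@algc K A) algc_is_zmod.
HB.instance Definition _ (K : comPzRingType) (A : superAlgType K) :=
  GRing.isMonoidMorphism.Build K A (@algc K A) algc_is_monoid.
HB.instance Definition _ (K : comPzRingType) (A : superAlgType K) d :=
  GRing.isZmodMorphism.Build A A (@spart K A d) (spart_is_zmod d).

Definition superalg_morphism (K : comPzRingType) (A B : superAlgType K)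
    (f : A -> B) : Prop :=
  [/\ zmod_morphism f, monoid_morphism f,
      forall c : K, f (algc c) = algc c
    & forall d x, f (spart d x) = spart d (f x)].

Section SuperAlgebraTheory.
Variables (K : comPzRingType) (A : superAlgType K).
Implicit Types (x y : A).

Lemma spart_ind (P : A -> Prop) :
  (forall x y, P x -> P y -> P (x + y)) ->
  (forall d x, spart d x = x -> P x) -> forall x, P x.
Proof.
move=> PD Ph x; rewrite -(spart_sum x).
by apply: PD; [apply: (Ph false)|apply: (Ph true)]; rewrite spart_spart eqxx.
Qed.

Lemma spart_homog d e x : spart d x = x -> spart e x = if e == d then x else 0.
Proof. by move=> hx; rewrite -{1}hx spart_spart hx. Qed.

Lemma spart_homogM d e x y : spart d x = x -> spart e y = y ->
  spart (d (+) e) (x * y) = x * y.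
Proof. by move=> hx hy; rewrite -hx -hy spart_mul. Qed.

Lemma spart1 : spart false (1 : A) = 1.
Proof.
have H x : spart true 1 * x = 0.
  move: x; apply: spart_ind => [x y hx hy|e x hx].
    by rewrite mulrDr hx hy addr0.
  have E : x = spart false 1 * x + spart true 1 * x.
    by rewrite -mulrDl spart_sum mul1r.
  have hid d : spart d (spart d (1 : A)) = spart d 1.
    by rewrite spart_spart eqxx.
  move/(congr1 (spart (~~ e))): E.
  rewrite raddfD /= (spart_homog (~~ e) (spart_homogM (hid false) hx)).
  rewrite (spart_homog (~~ e) (spart_homogM (hid true) hx)).
  rewrite (spart_homog (~~ e) hx).
  by case: (e) => /=; rewrite add0r => <-.
by move: (spart_sum (1 : A)); rewrite -[spart true 1]mulr1 H addr0.
Qed.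

Lemma spart_algc1 d c : spart d (algc c : A) = if d then 0 else algc c.
Proof.
by rewrite -[algc c]mulr1 spart_algc (spart_homog d spart1);
  case: d; rewrite /= ?mulr0.
Qed.

End SuperAlgebraTheory.

Section Terms.
Variables (K : comPzRingType) (X : Type).

Inductive nc_term : Type :=
| nc_var of X
| nc_cst of K
| nc_add of nc_term & nc_term
| nc_mul of nc_term & nc_term.

(* The congruence generated by the relations r and the axioms of
   associative unital K-algebras. *)
Inductive nc_eqv (r : nc_term -> nc_term -> Prop) :
    nc_term -> nc_term -> Prop :=
| nc_rel s t : r s t -> nc_eqv r s t
| nc_refl s : nc_eqv r s s
| nc_sym s t : nc_eqv r s t -> nc_eqv r t s
| nc_trans t s u : nc_eqv r s t -> nc_eqv r t u -> nc_eqv r s u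
| nc_congD s s' t t' : nc_eqv r s s' -> nc_eqv r t t' ->
    nc_eqv r (nc_add s t) (nc_add s' t')
| nc_congM s s' t t' : nc_eqv r s s' -> nc_eqv r t t' ->
    nc_eqv r (nc_mul s t) (nc_mul s' t')
| nc_addA s t u :
    nc_eqv r (nc_add s (nc_add t u)) (nc_add (nc_add s t) u)
| nc_addC s t : nc_eqv r (nc_add s t) (nc_add t s)
| nc_add0 s : nc_eqv r (nc_add (nc_cst 0) s) s
| nc_mulA s t u :
    nc_eqv r (nc_mul s (nc_mul t u)) (nc_mul (nc_mul s t) u)
| nc_mul0 s : nc_eqv r (nc_mul (nc_cst 0) s) (nc_cst 0)
| nc_mul1 s : nc_eqv r (nc_mul (nc_cst 1) s) s
| nc_mulDl s t u :
    nc_eqv r (nc_mul (nc_add s t) u) (nc_add (nc_mul s u) (nc_mul t u))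
| nc_mulDr s t u :
    nc_eqv r (nc_mul u (nc_add s t)) (nc_add (nc_mul u s) (nc_mul u t))
| nc_cstC c s : nc_eqv r (nc_mul (nc_cst c) s) (nc_mul s (nc_cst c))
| nc_cstD c c' :
    nc_eqv r (nc_cst (c + c')) (nc_add (nc_cst c) (nc_cst c'))
| nc_cstM c c' :
    nc_eqv r (nc_cst (c * c')) (nc_mul (nc_cst c) (nc_cst c')).

Definition nc_opp (t : nc_term) : nc_term := nc_mul (nc_cst (-1)) t.
Definition nc_exp (t : nc_term) (m : nat) : nc_term :=
  iter m (nc_mul t) (nc_cst 1).

Variable par : X -> bool.

Fixpoint nc_part (d : bool) (t : nc_term) : nc_term :=
  match t with
  | nc_var x => if d == par x then nc_var x else nc_cst 0
  | nc_cst c => if d then nc_cst 0 else nc_cst c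
  | nc_add s u => nc_add (nc_part d s) (nc_part d u)
  | nc_mul s u =>
      nc_add (nc_mul (nc_part false s) (nc_part d u))
             (nc_mul (nc_part true s) (nc_part (~~ d) u))
  end.

Fixpoint nc_homog (d : bool) (t : nc_term) : Prop :=
  match t with
  | nc_var x => par x = d
  | nc_cst _ => d = false
  | nc_add s u => nc_homog d s /\ nc_homog d u
  | nc_mul s u => exists e, nc_homog e s /\ nc_homog (d (+) e) u
  end.

Lemma nc_homog_exp2 e m t u : nc_homog e t -> nc_homog e u ->
  nc_homog false (nc_exp (nc_mul t u) m).
Proof.
move=> ht hu; elim: m => //= m IHm; exists false; split=> //.
by exists e; rewrite addFb.
Qed.

End Terms.

Arguments nc_var {K X}.
Arguments nc_cst {K X}.

Fixpoint nc_map (K : comPzRingType) (X Y : Type) (f : X -> Y)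
    (t : nc_term K X) : nc_term K Y :=
  match t with
  | nc_var x => nc_var (f x)
  | nc_cst c => nc_cst c
  | nc_add s u => nc_add (nc_map f s) (nc_map f u)
  | nc_mul s u => nc_mul (nc_map f s) (nc_map f u)
  end.

Lemma nc_homog_map (K : comPzRingType) (X Y : Type) (f : X -> Y)
    (par : X -> bool) (par' : Y -> bool) d (t : nc_term K X) :
  (forall x, par' (f x) = par x) ->
  nc_homog par d t -> nc_homog par' d (nc_map f t).
Proof.
move=> hf; elim: t d => [x|c|s IHs t IHt|s IHs t IHt] d //=.
- by rewrite hf.
- by move=> [/IHs hs /IHt].
- by move=> [e [/IHs hs /IHt ht]]; exists e.
Qed.

Record presentation (K : comPzRingType) := Presentation {
  gen : Type;
  gpar : gen -> bool;
  grel : nc_term K gen -> nc_term K gen -> Prop;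
  grel_homog : forall s t, grel s t ->
    exists d, nc_homog gpar d s /\ nc_homog gpar d t
}.

Section PresentedAlgebra.
Variables (K : comPzRingType) (P : presentation K).

Local Notation term := {classic nc_term K (gen P)}.
Local Notation eqv := (nc_eqv (@grel K P)).
Local Notation part := (nc_part (@gpar K P)).

Definition pres_eqv : rel term := fun s t => `[< eqv s t >].

Lemma pres_eqv_refl : reflexive pres_eqv.
Proof. by move=> s; apply/asboolP; exact: nc_refl. Qed.

Lemma pres_eqv_sym : symmetric pres_eqv.
Proof.
by move=> s t; apply/asboolP/asboolP => h; exact: nc_sym.
Qed.

Lemma pres_eqv_trans : transitive pres_eqv.
Proof.
move=> t s u /asboolP h1 /asboolP h2; apply/asboolP; exact: nc_trans h1 h2.
Qed.

Canonical pres_equiv :=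
  EquivRel pres_eqv pres_eqv_refl pres_eqv_sym pres_eqv_trans.

Definition pres_alg : Type := {eq_quot pres_equiv}%qT.

HB.instance Definition _ := Choice.copy pres_alg {eq_quot pres_equiv}%qT.

Definition pcl (t : nc_term K (gen P)) : pres_alg :=
  \pi_({eq_quot pres_equiv})%qT (t : term).
Definition prep (x : pres_alg) : nc_term K (gen P) :=
  repr (x : {eq_quot pres_equiv}%qT).

Lemma pclP s t : pcl s = pcl t <-> eqv s t.
Proof.
split=> [/eqP|h].
  by rewrite /pcl eqmodE => /asboolP.
by apply/eqP; rewrite /pcl eqmodE; apply/asboolP.
Qed.

Lemma prepK x : pcl (prep x) = x.
Proof. exact: reprK. Qed.

Lemma pcl_ind (Q : pres_alg -> Prop) : (forall t, Q (pcl t)) -> forall x, Q x.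
Proof. by move=> h x; rewrite -(prepK x). Qed.

Lemma prep_pcl t : eqv (prep (pcl t)) t.
Proof. by apply/pclP; rewrite prepK. Qed.

Definition pgen (g : gen P) : pres_alg := pcl (nc_var g).

Definition pres_cst (c : K) : pres_alg := pcl (nc_cst c).
Definition pres_add (x y : pres_alg) := pcl (nc_add (prep x) (prep y)).
Definition pres_mul (x y : pres_alg) := pcl (nc_mul (prep x) (prep y)).
Definition pres_opp (x : pres_alg) := pcl (nc_opp (prep x)).
Definition pres_part d (x : pres_alg) := pcl (part d (prep x)).

Lemma pres_addE s t : pres_add (pcl s) (pcl t) = pcl (nc_add s t).
Proof. by apply/pclP/nc_congD; exact: prep_pcl. Qed.

Lemma pres_mulE s t : pres_mul (pcl s) (pcl t) = pcl (nc_mul s t).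
Proof. by apply/pclP/nc_congM; exact: prep_pcl. Qed.

Lemma pres_oppE t : pres_opp (pcl t) = pcl (nc_opp t).
Proof. by apply/pclP/nc_congM; [exact: nc_refl|exact: prep_pcl]. Qed.

Fact pres_addA : associative pres_add.
Proof.
elim/pcl_ind=> s; elim/pcl_ind=> t; elim/pcl_ind=> u.
by rewrite !pres_addE; apply/pclP; exact: nc_addA.
Qed.

Fact pres_addC : commutative pres_add.
Proof.
elim/pcl_ind=> s; elim/pcl_ind=> t.
by rewrite !pres_addE; apply/pclP; exact: nc_addC.
Qed.

Fact pres_add0 : left_id (pres_cst 0) pres_add.
Proof.
elim/pcl_ind=> s; rewrite pres_addE; apply/pclP; exact: nc_add0.
Qed.

Fact pres_mulA : associative pres_mul.
Proof.
elim/pcl_ind=> s; elim/pcl_ind=> t; elim/pcl_ind=> u.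
by rewrite !pres_mulE; apply/pclP; exact: nc_mulA.
Qed.

Fact pres_cstC c x : pres_mul (pres_cst c) x = pres_mul x (pres_cst c).
Proof.
elim/pcl_ind: x => s; rewrite !pres_mulE; apply/pclP; exact: nc_cstC.
Qed.

Fact pres_mul1 : left_id (pres_cst 1) pres_mul.
Proof.
elim/pcl_ind=> s; rewrite pres_mulE; apply/pclP; exact: nc_mul1.
Qed.

Fact pres_mulr1 : right_id (pres_cst 1) pres_mul.
Proof. by move=> x; rewrite -pres_cstC pres_mul1. Qed.

Fact pres_mulDl : left_distributive pres_mul pres_add.
Proof.
elim/pcl_ind=> s; elim/pcl_ind=> t; elim/pcl_ind=> u.
by rewrite !(pres_mulE, pres_addE); apply/pclP; exact: nc_mulDl.
Qed.

Fact pres_mulDr : right_distributive pres_mul pres_add.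
Proof.
elim/pcl_ind=> s; elim/pcl_ind=> t; elim/pcl_ind=> u.
by rewrite !(pres_mulE, pres_addE); apply/pclP; exact: nc_mulDr.
Qed.

Fact pres_cstD c c' : pres_cst (c + c') = pres_add (pres_cst c) (pres_cst c').
Proof. by rewrite pres_addE; apply/pclP; exact: nc_cstD. Qed.

Fact pres_cstM c c' : pres_cst (c * c') = pres_mul (pres_cst c) (pres_cst c').
Proof. by rewrite pres_mulE; apply/pclP; exact: nc_cstM. Qed.

Fact pres_mul0 x : pres_mul (pres_cst 0) x = pres_cst 0.
Proof. by elim/pcl_ind: x => s; rewrite pres_mulE; apply/pclP; exact: nc_mul0. Qed.

Fact pres_addN : left_inverse (pres_cst 0) pres_opp pres_add.
Proof.
move=> x; have -> : pres_opp x = pres_mul (pres_cst (-1)) x.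
  by elim/pcl_ind: x => s; rewrite pres_oppE pres_mulE.
by rewrite -{2}(pres_mul1 x) -pres_mulDl -pres_cstD addNr pres_mul0.
Qed.

HB.instance Definition _ := GRing.isPzRing.Build pres_alg
  pres_addA pres_addC pres_add0 pres_addN
  pres_mulA pres_mul1 pres_mulr1 pres_mulDl pres_mulDr.

Lemma pclD s t : pcl (nc_add s t) = pcl s + pcl t.
Proof. by rewrite -pres_addE. Qed.

Lemma pclM s t : pcl (nc_mul s t) = pcl s * pcl t.
Proof. by rewrite -pres_mulE. Qed.

Lemma pclX t m : pcl (nc_exp t m) = pcl t ^+ m.
Proof. by elim: m => //= m IHm; rewrite pclM IHm exprS. Qed.

Fact pres_cst_zmod : zmod_morphism pres_cst.
Proof.
move=> c c'; apply: (@addIr _ (pres_cst c')); rewrite subrK.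
by rewrite -[in RHS](subrK c' c) [RHS]pres_cstD.
Qed.

Fact pres_cst_monoid : monoid_morphism pres_cst.
Proof. by split=> // c c'; exact: pres_cstM. Qed.

Lemma part_homog d e t : nc_homog (@gpar K P) d t ->
  pcl (part e t) = if e == d then pcl t else 0.
Proof.
elim: t d e => [x|c|s IHs t IHt|s IHs t IHt] d e /=.
- by move=> ->; case: eqP.
- by move=> ->; case: e.
- move=> [hs ht]; rewrite !pclD (IHs d) // (IHt d) //.
  by case: eqP; rewrite ?addr0.
- move=> [f [hs ht]]; rewrite pclD !pclM !(IHs f) // !(IHt (d (+) f)) //.
  by case: e d f {hs ht} => [] [] []; rewrite /= ?mul0r ?mulr0 ?addr0 ?add0r.
Qed.

Lemma part_eqv d s t : eqv s t -> pcl (part d s) = pcl (part d t).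
Proof.
move=> h; elim: h d => {s t}.
- move=> s t r d; have [e [hs ht]] := grel_homog r.
  rewrite (part_homog _ hs) (part_homog _ ht).
  by have /pclP -> : eqv s t by exact: nc_rel.
- by [].
- by move=> s t _ IH d; rewrite IH.
- by move=> t s u _ IH1 _ IH2 d; rewrite IH1 IH2.
- by move=> s s' t t' _ IH1 _ IH2 d; rewrite /= !pclD IH1 IH2.
- by move=> s s' t t' _ IH1 _ IH2 d; rewrite /= !(pclD, pclM) !IH1 !IH2.
- by move=> s t u d; rewrite /= !pclD addrA.
- by move=> s t d; rewrite /= !pclD addrC.
- by move=> s d; rewrite /= !pclD; case: d; rewrite add0r.
- move=> s t u d; rewrite /= !(pclD, pclM) negbK !mulrDl !mulrDr !mulrA.
  by rewrite [X in _ + X = _]addrC addrACA.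
- by move=> s d; rewrite /= !(pclD, pclM) !mul0r addr0; case: d.
- by move=> s d; rewrite /= !(pclD, pclM) mul0r addr0 mul1r.
- by move=> s t u d; rewrite /= !(pclD, pclM) !mulrDl addrACA.
- by move=> s t u d; rewrite /= !(pclD, pclM) !mulrDr addrACA.
- move=> c s d; rewrite /= !(pclD, pclM) mul0r addr0.
  by case: d => /=; rewrite mulr0 ?addr0 ?add0r; exact: pres_cstC.
- by move=> c c' [] /=; [rewrite pclD addr0|apply/pclP; exact: nc_cstD].
- move=> c c' [] /=; rewrite !(pclD, pclM) ?mulr0 ?mul0r ?addr0 //.
  exact: pres_cstM.
Qed.

Lemma pres_partE d t : pres_part d (pcl t) = pcl (part d t).
Proof. by apply: part_eqv; exact: prep_pcl. Qed.

Fact pres_part_zmod d : zmod_morphism (pres_part d).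
Proof.
have D x y : pres_part d (x + y) = pres_part d x + pres_part d y.
  by elim/pcl_ind: x => s; elim/pcl_ind: y => t; rewrite -pclD !pres_partE -pclD.
by move=> x y; apply: (@addIr _ (pres_part d y)); rewrite -D !subrK.
Qed.

Fact pres_part_cst d c x :
  pres_part d (pres_cst c * x) = pres_cst c * pres_part d x.
Proof.
elim/pcl_ind: x => t; rewrite /pres_cst -pclM !pres_partE /=.
by rewrite pclD !pclM mul0r addr0.
Qed.

Fact pres_part_sum x : pres_part false x + pres_part true x = x.
Proof.
elim/pcl_ind: x => t; rewrite !pres_partE.
elim: t => [x|c|s IHs t IHt|s IHs t IHt] /=.
- by case: (gpar x); rewrite ?add0r ?addr0.
- by rewrite addr0.
- by rewrite !pclD addrACA IHs IHt.
- rewrite !(pclD, pclM) addrACA -!mulrDr IHt [pcl (part true t) + _]addrC.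
  by rewrite IHt -mulrDl IHs.
Qed.

Fact pres_part_part d e x : pres_part d (pres_part e x) =
  if d == e then pres_part e x else 0.
Proof.
elim/pcl_ind: x => t; rewrite !pres_partE.
elim: t d e => [x|c|s IHs t IHt|s IHs t IHt] d e /=.
- case: eqP => [->|ne] /=; first by case: eqP.
  by rewrite if_same; case: eqP.
- by case: d e => [] [].
- by rewrite !pclD IHs IHt; case: eqP; rewrite ?addr0.
- rewrite !(pclD, pclM) !IHs !IHt.
  by case: d e => [] []; rewrite /= ?mul0r ?mulr0 ?addr0 ?add0r // addrC.
Qed.

Fact pres_part_mul d e x y :
  pres_part (d (+) e) (pres_part d x * pres_part e y)
    = pres_part d x * pres_part e y.
Proof.
elim/pcl_ind: x => s; elim/pcl_ind: y => t.
rewrite (pres_partE d s) (pres_partE e t) -pclM pres_partE.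
rewrite /= pclD !pclM -!pres_partE !pres_part_part.
by case: d e => [] []; rewrite /= ?mul0r ?mulr0 ?addr0 ?add0r.
Qed.

HB.instance Definition _ := isSuperAlgebra.Build K pres_alg
  pres_cst_zmod pres_cst_monoid pres_cstC pres_part_zmod
  pres_part_cst pres_part_sum pres_part_part pres_part_mul.

Lemma spart_pgen d g : spart d (pgen g) = if d == gpar g then pgen g else 0.
Proof. by rewrite [LHS]pres_partE /=; case: eqP. Qed.

Section Lift.
Variables (B : superAlgType K) (f : gen P -> B).

Fixpoint nc_eval (t : nc_term K (gen P)) : B :=
  match t with
  | nc_var g => f g
  | nc_cst c => algc c
  | nc_add s u => nc_eval s + nc_eval u
  | nc_mul s u => nc_eval s * nc_eval u
  end.

Definition plift (x : pres_alg) : B := nc_eval (prep x).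

Hypothesis f_rel : forall s t, grel s t -> nc_eval s = nc_eval t.

Lemma nc_eval_eqv s t : eqv s t -> nc_eval s = nc_eval t.
Proof.
elim=> {s t} /=.
- exact: f_rel.
- by [].
- by [].
- by move=> t s u _ -> _ ->.
- by move=> s s' t t' _ -> _ ->.
- by move=> s s' t t' _ -> _ ->.
- by move=> *; rewrite addrA.
- by move=> *; rewrite addrC.
- by move=> *; rewrite raddf0 add0r.
- by move=> *; rewrite mulrA.
- by move=> *; rewrite raddf0 mul0r.
- by move=> *; rewrite rmorph1 mul1r.
- by move=> *; rewrite mulrDl.
- by move=> *; rewrite mulrDr.
- by move=> *; rewrite algcC.
- by move=> *; rewrite raddfD.
- by move=> *; rewrite rmorphM.
Qed.

Lemma plift_pcl t : plift (pcl t) = nc_eval t.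
Proof. by apply: nc_eval_eqv; exact: prep_pcl. Qed.

Lemma plift_pgen g : plift (pgen g) = f g.
Proof. exact: plift_pcl. Qed.

Lemma plift_morphism :
  (forall d g, spart d (f g) = if d == gpar g then f g else 0) ->
  superalg_morphism plift.
Proof.
move=> fpar.
have plD x y : plift (x + y) = plift x + plift y.
  by elim/pcl_ind: x => s; elim/pcl_ind: y => t; rewrite -pclD !plift_pcl.
split.
- by move=> x y; apply: (@addIr _ (plift y)); rewrite -plD !subrK.
- split=> [|x y]; first by rewrite [LHS]plift_pcl /= rmorph1.
  by elim/pcl_ind: x => s; elim/pcl_ind: y => t; rewrite -pclM !plift_pcl.
- by move=> c; rewrite [LHS]plift_pcl.
- move=> d x; elim/pcl_ind: x => t; rewrite [spart d (pcl t)]pres_partE.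
  rewrite !plift_pcl; elim: t d => [g|c|s IHs t IHt|s IHs t IHt] d /=.
  + by rewrite fpar; case: eqP => //= _; rewrite raddf0.
  + by rewrite spart_algc1; case: d => //=; rewrite raddf0.
  + by rewrite raddfD /= IHs IHt.
  + rewrite !IHs !IHt -{3}(spart_sum (nc_eval s)).
    rewrite -{3}(spart_sum (nc_eval t)) mulrDl !mulrDr !raddfD /=.
    have hom e e' x y : spart d (spart e x * spart e' y : B) =
        if d == e (+) e' then spart e x * spart e' y else 0.
      by apply: spart_homog; rewrite spart_mul.
    by rewrite !hom; case: d {hom}; rewrite /= ?addr0 ?add0r // addrC.
Qed.

End Lift.

End PresentedAlgebra.

Section Tensor.
Variables (K : comPzRingType) (A B : superAlgType K).

Local Notation fsum := (seq (A * B)).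

(* A formal sum [:: (a1, b1); ...] stands for a1 (x) b1 + ... *)
Inductive tens_eqv : fsum -> fsum -> Prop :=
| tens_refl s : tens_eqv s s
| tens_sym s t : tens_eqv s t -> tens_eqv t s
| tens_trans t s u : tens_eqv s t -> tens_eqv t u -> tens_eqv s u
| tens_cat s s' t t' : tens_eqv s s' -> tens_eqv t t' ->
    tens_eqv (s ++ t) (s' ++ t')
| tens_catC s t : tens_eqv (s ++ t) (t ++ s)
| tens_addl a a' b : tens_eqv [:: (a + a', b)] [:: (a, b); (a', b)]
| tens_addr a b b' : tens_eqv [:: (a, b + b')] [:: (a, b); (a, b')]
| tens_zero b : tens_eqv [:: (0, b)] [::]
| tens_scale c a b : tens_eqv [:: (algc c * a, b)] [:: (a, algc c * b)].

Definition tens_eqb : rel {classic fsum} := fun s t => `[< tens_eqv s t >].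

Lemma tens_eqb_refl : reflexive tens_eqb.
Proof. by move=> s; apply/asboolP; exact: tens_refl. Qed.

Lemma tens_eqb_sym : symmetric tens_eqb.
Proof. by move=> s t; apply/asboolP/asboolP => h; exact: tens_sym. Qed.

Lemma tens_eqb_trans : transitive tens_eqb.
Proof.
move=> t s u /asboolP h1 /asboolP h2; apply/asboolP; exact: tens_trans h1 h2.
Qed.

Canonical tens_equiv :=
  EquivRel tens_eqb tens_eqb_refl tens_eqb_sym tens_eqb_trans.

Definition stensor : Type := {eq_quot tens_equiv}%qT.

HB.instance Definition _ := Choice.copy stensor {eq_quot tens_equiv}%qT.

Definition tcl (s : fsum) : stensor :=
  \pi_({eq_quot tens_equiv})%qT (s : {classic fsum}).
Definition trep (x : stensor) : fsum := repr (x : {eq_quot tens_equiv}%qT).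

Lemma tclP s t : tcl s = tcl t <-> tens_eqv s t.
Proof.
split=> [/eqP|h]; first by rewrite /tcl eqmodE => /asboolP.
by apply/eqP; rewrite /tcl eqmodE; apply/asboolP.
Qed.

Lemma trepK x : tcl (trep x) = x.
Proof. exact: reprK. Qed.

Lemma tcl_ind (Q : stensor -> Prop) : (forall s, Q (tcl s)) -> forall x, Q x.
Proof. by move=> h x; rewrite -(trepK x). Qed.

Lemma trep_tcl s : tens_eqv (trep (tcl s)) s.
Proof. by apply/tclP; rewrite trepK. Qed.

Definition tens (a : A) (b : B) : stensor := tcl [:: (a, b)].

Definition tens_add (x y : stensor) := tcl (trep x ++ trep y).
Definition tens_opp (x : stensor) := tcl [seq (- p.1, p.2) | p <- trep x].

Lemma tens_addE s t : tens_add (tcl s) (tcl t) = tcl (s ++ t).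
Proof. by apply/tclP/tens_cat; exact: trep_tcl. Qed.

Fact tens_addA : associative tens_add.
Proof.
by elim/tcl_ind=> s; elim/tcl_ind=> t; elim/tcl_ind=> u; rewrite !tens_addE catA.
Qed.

Fact tens_addC : commutative tens_add.
Proof.
elim/tcl_ind=> s; elim/tcl_ind=> t; rewrite !tens_addE.
by apply/tclP; exact: tens_catC.
Qed.

Fact tens_add0 : left_id (tcl [::]) tens_add.
Proof. by elim/tcl_ind=> s; rewrite tens_addE. Qed.

Fact tens_addN : left_inverse (tcl [::]) tens_opp tens_add.
Proof.
move=> x; rewrite -{2}[x]trepK /tens_opp; elim: (trep x) => [|[a b] s IHs] /=.
  by rewrite tens_addE.
rewrite tens_addE; apply/tclP.
apply: (@tens_trans
  ([:: (- a, b); (a, b)] ++ ([seq (- p.1, p.2) | p <- s] ++ s))).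
  rewrite -[(- a, b) :: _ as X in tens_eqv (X ++ _) _]/([:: (- a, b)] ++ _).
  rewrite -[(a, b) :: s]/([:: (a, b)] ++ s).
  rewrite -[[:: (- a, b); (a, b)]]/([:: (- a, b)] ++ [:: (a, b)]) -!catA.
  apply: tens_cat; first exact: tens_refl.
  rewrite !catA; apply: tens_cat; [exact: tens_catC|exact: tens_refl].
apply: (@tens_trans ([::] ++ [::])); last exact: tens_refl.
apply: tens_cat; last by apply/tclP; rewrite -tens_addE.
apply: tens_trans (tens_sym (tens_addl _ _ _)) _.
by rewrite addNr; exact: tens_zero.
Qed.

HB.instance Definition _ := GRing.isZmodule.Build stensor
  tens_addA tens_addC tens_add0 tens_addN.

Lemma tclD s t : tcl (s ++ t) = tcl s + tcl t.
Proof. by rewrite -tens_addE. Qed.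

Lemma tcl_sum s : tcl s = \sum_(p <- s) tens p.1 p.2.
Proof.
elim: s => [|[a b] s IHs]; first by rewrite big_nil.
by rewrite big_cons -IHs -tclD.
Qed.

Lemma tensDl a a' b : tens (a + a') b = tens a b + tens a' b.
Proof. by rewrite -tclD; apply/tclP; exact: tens_addl. Qed.

Lemma tensDr a b b' : tens a (b + b') = tens a b + tens a b'.
Proof. by rewrite -tclD; apply/tclP; exact: tens_addr. Qed.

Lemma tens0l b : tens 0 b = 0.
Proof. by apply/tclP; exact: tens_zero. Qed.

Lemma tens0r a : tens a 0 = 0.
Proof. by apply: (@addrI _ (tens a 0)); rewrite -tensDr !addr0. Qed.

Lemma tensZ c a b : tens (algc c * a) b = tens a (algc c * b).
Proof. by apply/tclP; exact: tens_scale. Qed.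

Lemma tens_ind (Q : stensor -> Prop) :
  (forall x y, Q x -> Q y -> Q (x + y)) -> (forall a b, Q (tens a b)) ->
  forall x, Q x.
Proof.
move=> QD Qt; elim/tcl_ind=> s; elim: s => [|[a b] s IHs].
  by have <- : tens 0 0 = tcl [::]; [exact: tens0l|exact: Qt].
by rewrite -[_ :: _]/([:: (a, b)] ++ s) tclD; apply: QD => //; exact: Qt.
Qed.

Lemma tens_homog_ind (Q : stensor -> Prop) :
  (forall x y, Q x -> Q y -> Q (x + y)) ->
  (forall d e a b, spart d a = a -> spart e b = b -> Q (tens a b)) ->
  forall x, Q x.
Proof.
move=> QD Qt; apply: tens_ind => // a b.
move: a; apply: spart_ind => [a a' h h'|d a ha]; first by rewrite tensDl; apply: QD.
move: b; apply: spart_ind => [b b' h h'|e b hb]; first by rewrite tensDr; apply: QD.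
exact: Qt ha hb.
Qed.

Section TensorLift.
Variables (V : zmodType) (f : A -> B -> V).

Definition tlift (x : stensor) : V := \sum_(p <- trep x) f p.1 p.2.

Definition balanced : Prop :=
  [/\ forall a a' b, f (a + a') b = f a b + f a' b,
      forall a b b', f a (b + b') = f a b + f a b'
    & forall c a b, f (algc c * a) b = f a (algc c * b)].

Hypothesis hf : balanced.

Lemma tlift_tcl s : tlift (tcl s) = \sum_(p <- s) f p.1 p.2.
Proof.
have [fDl fDr fZ] := hf.
have f0 b : f 0 b = 0 by apply: (@addrI _ (f 0 b)); rewrite -fDl !addr0.
suff H s1 s2 : tens_eqv s1 s2 ->
    \sum_(p <- s1) f p.1 p.2 = \sum_(p <- s2) f p.1 p.2.
  exact: H (trep_tcl s).
elim=> {s s1 s2} //.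
- by move=> t s u _ -> _ ->.
- by move=> s s' t t' _ IH _ IH'; rewrite !big_cat /= IH IH'.
- by move=> s t; rewrite !big_cat /= addrC.
- by move=> a a' b; rewrite !big_cons big_nil !addr0 /= fDl.
- by move=> a b b'; rewrite !big_cons big_nil !addr0 /= fDr.
- by move=> b; rewrite !big_cons big_nil !addr0 /= f0.
- by move=> c a b; rewrite !big_cons big_nil !addr0 /= fZ.
Qed.

Lemma tlift_tens a b : tlift (tens a b) = f a b.
Proof. by rewrite tlift_tcl big_seq1. Qed.

Lemma tliftD x y : tlift (x + y) = tlift x + tlift y.
Proof.
elim/tcl_ind: x => s; elim/tcl_ind: y => t.
by rewrite -tclD !tlift_tcl big_cat.
Qed.

End TensorLift.

(* For homogeneous b and a' the only nonzero term of the sum is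
   (-1)^(|b||a'|) aa' (x) bb'. *)
Definition tens_mul2 (a : A) (b : B) (a' : A) (b' : B) : stensor :=
  \sum_(d : bool) \sum_(e : bool)
    (tens (a * spart e a') (spart d b * b')) *~ ((-1) ^+ (d && e)).

Definition tens_mul (x y : stensor) : stensor :=
  tlift (fun a b => tlift (tens_mul2 a b) y) x.

Definition tens_part2 d (a : A) (b : B) : stensor :=
  \sum_(e : bool) tens (spart e a) (spart (d (+) e) b).

Definition tens_part d (x : stensor) : stensor := tlift (tens_part2 d) x.

Definition tens_cst (c : K) : stensor := tens (algc c) 1.

Lemma tens_mul2_balanced a b : balanced (tens_mul2 a b).
Proof.
split=> [a1 a2 b'|a' b1 b2|c a' b']; rewrite /tens_mul2 -?big_split /=.
- apply: eq_bigr => d _; rewrite -big_split; apply: eq_bigr => e _ /=.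
  by rewrite raddfD mulrDr tensDl mulrzDl.
- apply: eq_bigr => d _; rewrite -big_split; apply: eq_bigr => e _ /=.
  by rewrite mulrDr tensDr mulrzDl.
- apply: eq_bigr => d _; apply: eq_bigr => e _ /=.
  by rewrite spart_algc (mulrA a) -(algcC c a) -mulrA tensZ !mulrA algcC.
Qed.

Lemma tens_mul_balanced y : balanced (fun a b => tlift (tens_mul2 a b) y).
Proof.
have h := tens_mul2_balanced.
split=> [a a' b|a b b'|c a b]; elim/tens_ind: y => [x y IHx IHy|u v];
  rewrite ?(tliftD (h _ _)) ?(tlift_tens (h _ _)) ?IHx ?IHy //.
- by rewrite addrACA.
- rewrite /tens_mul2 -?big_split /=.
  apply: eq_bigr => d _; rewrite -big_split; apply: eq_bigr => e _ /=.
  by rewrite mulrDl tensDl mulrzDl.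
- by rewrite addrACA.
- rewrite /tens_mul2 -?big_split /=.
  apply: eq_bigr => d _; rewrite -big_split; apply: eq_bigr => e _ /=.
  by rewrite raddfD mulrDl tensDr mulrzDl.
- rewrite /tens_mul2; apply: eq_bigr => d _; apply: eq_bigr => e _ /=.
  by rewrite spart_algc -!mulrA tensZ.
Qed.

Lemma tens_part2_balanced d : balanced (tens_part2 d).
Proof.
split=> [a1 a2 b'|a' b1 b2|c a' b']; rewrite /tens_part2 -?big_split /=;
  apply: eq_bigr => e _.
- by rewrite raddfD tensDl.
- by rewrite raddfD tensDr.
- by rewrite !spart_algc tensZ.
Qed.

Lemma tens_mulDl : left_distributive tens_mul +%R.
Proof. by move=> x y z; rewrite /tens_mul tliftD //; exact: tens_mul_balanced. Qed.

Lemma tens_mulDr : right_distributive tens_mul +%R.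
Proof.
move=> x y z; elim/tens_ind: x => [x1 x2 IH1 IH2|a b].
  by rewrite !tens_mulDl IH1 IH2 addrACA.
by rewrite /tens_mul !(tlift_tens (tens_mul_balanced _)) tliftD //;
  exact: tens_mul2_balanced.
Qed.

Lemma tens_mul_tens a b a' b' :
  tens_mul (tens a b) (tens a' b') = tens_mul2 a b a' b'.
Proof.
by rewrite /tens_mul !(tlift_tens (tens_mul_balanced _))
  (tlift_tens (tens_mul2_balanced _ _)).
Qed.

Lemma tens_mul_homog d e a b a' b' : spart d b = b -> spart e a' = a' ->
  tens_mul (tens a b) (tens a' b') = tens (a * a') (b * b') *~ (-1) ^+ (d && e).
Proof.
move=> hb ha; rewrite tens_mul_tens /tens_mul2 !big_bool /=.
rewrite !(spart_homog _ ha) !(spart_homog _ hb).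
by case: d e {ha hb} => [] []; rewrite /= ?mulr0 ?mul0r ?tens0l ?tens0r
  ?mul0rz ?addr0 ?add0r.
Qed.

Lemma tens_part_tens d a b : tens_part d (tens a b) = tens_part2 d a b.
Proof. by rewrite /tens_part tlift_tens //; exact: tens_part2_balanced. Qed.

Lemma tens_partD d x y : tens_part d (x + y) = tens_part d x + tens_part d y.
Proof. by rewrite /tens_part tliftD //; exact: tens_part2_balanced. Qed.

Lemma tens_part_homog f d e a b : spart d a = a -> spart e b = b ->
  tens_part f (tens a b) = if f == d (+) e then tens a b else 0.
Proof.
move=> ha hb; rewrite tens_part_tens /tens_part2 big_bool /=.
rewrite !(spart_homog _ ha) !(spart_homog _ hb).
by case: f d e {ha hb} => [] [] []; rewrite /= ?tens0l ?tens0r ?addr0 ?add0r.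
Qed.

Lemma tensNl a b : tens (- a) b = - tens a b.
Proof. by apply: (@addrI _ (tens a b)); rewrite -tensDl !subrr tens0l. Qed.

Fact tens_mulMz (x y : stensor) (m n : int) :
  tens_mul (x *~ m) (y *~ n) = tens_mul x y *~ (m * n).
Proof.
have l0 z : tens_mul 0 z = 0.
  by apply: (@addrI _ (tens_mul 0 z)); rewrite -tens_mulDl !addr0.
have r0 z : tens_mul z 0 = 0.
  by apply: (@addrI _ (tens_mul z 0)); rewrite -tens_mulDr !addr0.
have lB : forall z, zmod_morphism (tens_mul^~ z).
  move=> z u v; apply: (@addIr _ (tens_mul v z)).
  by rewrite -tens_mulDl !subrK.
have rB : forall z, zmod_morphism (tens_mul z).
  move=> z u v; apply: (@addIr _ (tens_mul z v)).
  by rewrite -tens_mulDr !subrK.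
pose L z : {additive stensor -> stensor} :=
  HB.pack (tens_mul^~ z) (GRing.isZmodMorphism.Build _ _ (tens_mul^~ z) (lB z)).
pose R z : {additive stensor -> stensor} :=
  HB.pack (tens_mul z) (GRing.isZmodMorphism.Build _ _ (tens_mul z) (rB z)).
rewrite -[LHS]/(L (y *~ n) (x *~ m)) raddfMz /= -[tens_mul _ _]/(R x (y *~ n)).
by rewrite raddfMz /= -mulrzA mulrC.
Qed.

Fact tens_mulA : associative tens_mul.
Proof.
move=> x y z.
elim/tens_homog_ind: x => [x1 x2 IH1 IH2|d1 e1 a1 b1 ha1 hb1].
  by rewrite !tens_mulDl IH1 IH2.
elim/tens_homog_ind: y => [y1 y2 IH1 IH2|d2 e2 a2 b2 ha2 hb2].
  by rewrite !(tens_mulDl, tens_mulDr) IH1 IH2.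
elim/tens_homog_ind: z => [z1 z2 IH1 IH2|d3 e3 a3 b3 ha3 hb3].
  by rewrite !(tens_mulDl, tens_mulDr) IH1 IH2.
rewrite (tens_mul_homog a2 b3 hb2 ha3) (tens_mul_homog a1 b2 hb1 ha2).
rewrite -[tens a1 b1]mulr1z -[tens a3 b3]mulr1z !tens_mulMz mulr1 mul1r.
rewrite (tens_mul_homog _ _ hb1 (spart_homogM ha2 ha3)).
rewrite (tens_mul_homog _ _ (spart_homogM hb1 hb2) ha3) !mulrA -!mulrzA.
congr (_ *~ _).
by case: e1 d2 e2 d3 {ha1 hb1 ha2 hb2 ha3 hb3} => [] [] [] [].
Qed.

Fact tens_mul1 : left_id (tens 1 1) tens_mul.
Proof.
elim/tens_homog_ind=> [x y IHx IHy|d e a b ha hb].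
  by rewrite tens_mulDr IHx IHy.
by rewrite (tens_mul_homog _ _ (spart1 B) ha) /= mulr1z !mul1r.
Qed.

Fact tens_mulr1 : right_id (tens 1 1) tens_mul.
Proof.
elim/tens_homog_ind=> [x y IHx IHy|d e a b ha hb].
  by rewrite tens_mulDl IHx IHy.
by rewrite (tens_mul_homog _ _ hb (spart1 A)) andbF mulr1z !mulr1.
Qed.

HB.instance Definition _ := GRing.Zmodule_isPzRing.Build stensor
  tens_mulA tens_mul1 tens_mulr1 tens_mulDl tens_mulDr.

Lemma tensM d e a b a' b' : spart d b = b -> spart e a' = a' ->
  tens a b * tens a' b' = (-1) ^+ (d && e) * tens (a * a') (b * b').
Proof.
move=> hb ha; rewrite [LHS](tens_mul_homog _ _ hb ha).
by case: (d && e); rewrite ?mulr1z ?mul1r // mulN1r mulrNz mulr1z.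
Qed.

Fact tens_cst_zmod : zmod_morphism tens_cst.
Proof. by move=> c c'; rewrite /tens_cst raddfB tensDl tensNl. Qed.

Lemma tens_cst_mul c a b : tens_cst c * tens a b = tens (algc c * a) b.
Proof.
elim/(@spart_ind _ A): a => [a a' h h'|d a ha].
  by rewrite tensDl mulrDr h h' mulrDr tensDl.
by rewrite (tensM _ _ (spart1 B) ha) /= !mul1r.
Qed.

Fact tens_cst_monoid : monoid_morphism tens_cst.
Proof.
split=> [|c c']; first by rewrite /tens_cst rmorph1.
by rewrite tens_cst_mul -rmorphM.
Qed.

Fact tens_cstC c x : tens_cst c * x = x * tens_cst c.
Proof.
elim/tens_homog_ind: x => [x y hx hy|d e a b ha hb].
  by rewrite mulrDl mulrDr hx hy.
rewrite tens_cst_mul (tensM a 1 hb (spart_algc1 A false c)).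
by rewrite andbF mul1r mulr1 algcC.
Qed.

Fact tens_part_zmod d : zmod_morphism (tens_part d).
Proof.
move=> x y; apply: (@addIr _ (tens_part d y)).
by rewrite -tens_partD !subrK.
Qed.

HB.instance Definition _ d := GRing.isZmodMorphism.Build _ _
  (tens_part d) (tens_part_zmod d).

Fact tens_part_cst d c x : tens_part d (tens_cst c * x) = tens_cst c * tens_part d x.
Proof.
elim/tens_ind: x => [x y hx hy|a b]; first by rewrite mulrDr !raddfD mulrDr /= hx hy.
rewrite tens_cst_mul !tens_part_tens /tens_part2 mulr_sumr.
by apply: eq_bigr => e _; rewrite tens_cst_mul spart_algc.
Qed.

Fact tens_part_sum x : tens_part false x + tens_part true x = x.
Proof.
elim/tens_homog_ind: x => [x y hx hy|d e a b ha hb].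
  by rewrite !tens_partD addrACA hx hy.
rewrite !(tens_part_homog _ ha hb).
by case: (d (+) e); rewrite ?addr0 ?add0r.
Qed.

Fact tens_part_part d e x : tens_part d (tens_part e x) =
  if d == e then tens_part e x else 0.
Proof.
elim/tens_homog_ind: x => [x y hx hy|f g a b ha hb].
  by rewrite !tens_partD hx hy; case: eqP; rewrite ?addr0.
rewrite !(tens_part_homog e ha hb) [e == _]eq_sym; case: eqP => [<-|_] /=.
  by rewrite (tens_part_homog d ha hb).
by rewrite raddf0 if_same.
Qed.

Fact tens_part_mul d e x y :
  tens_part (d (+) e) (tens_part d x * tens_part e y)
    = tens_part d x * tens_part e y.
Proof.
elim/tens_homog_ind: x => [x x' hx hx'|d1 e1 a1 b1 ha1 hb1].
  by rewrite !raddfD mulrDl raddfD /= hx hx'.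
elim/tens_homog_ind: y => [y y' hy hy'|d2 e2 a2 b2 ha2 hb2].
  by rewrite !raddfD mulrDr raddfD /= hy hy'.
rewrite !(tens_part_homog _ ha1 hb1) !(tens_part_homog _ ha2 hb2).
case: eqP => [->|_]; last by rewrite mul0r raddf0.
case: eqP => [->|_]; last by rewrite mulr0 raddf0.
rewrite (tensM _ _ hb1 ha2).
have h := tens_part_homog ((d1 (+) e1) (+) (d2 (+) e2))
  (spart_homogM ha1 ha2) (spart_homogM hb1 hb2).
rewrite [X in if X then _ else _](_ : _ = true) in h; last first.
  by rewrite addbACA eqxx.
by case: (e1 && d2); rewrite ?mul1r // mulN1r raddfN /= h.
Qed.

HB.instance Definition _ := isSuperAlgebra.Build K stensor
  tens_cst_zmod tens_cst_monoid tens_cstC tens_part_zmod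
  tens_part_cst tens_part_sum tens_part_part tens_part_mul.

End Tensor.

Arguments tens {K A B}.

Section PresentedMap.
Variables (K : comPzRingType) (P Q : presentation K) (h : gen P -> gen Q).

Definition pmap : pres_alg P -> pres_alg Q := plift (fun g => pgen (h g)).

Hypothesis h_rel : forall s t, grel s t -> grel (nc_map h s) (nc_map h t).
Hypothesis h_par : forall g, gpar (h g) = gpar g.

Lemma nc_eval_map t : nc_eval (fun g => pgen (h g)) t = pcl (nc_map h t).
Proof. by elim: t => //= s -> t ->; rewrite (pclD, pclM). Qed.

Lemma pmap_rel s t : grel s t ->
  nc_eval (fun g => pgen (h g)) s = nc_eval (fun g => pgen (h g)) t.
Proof.
by move=> r; rewrite !nc_eval_map; apply/pclP/nc_rel; exact: h_rel.
Qed.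

Lemma pmap_pgen g : pmap (pgen g) = pgen (h g).
Proof. exact: plift_pgen pmap_rel _. Qed.

Lemma pmap_morphism : superalg_morphism pmap.
Proof.
by apply: (plift_morphism pmap_rel) => d g; rewrite spart_pgen h_par.
Qed.

End PresentedMap.

(* Irreducible finite Weyl groups, by Cartan-Killing type. Node i of the
   Dynkin diagram is the natural number i.-1; nodes are numbered as in
   Bourbaki. The Weyl groups of types B_n and C_n coincide. *)
Inductive weyl_type : Type :=
| WA of nat | WB of nat | WD of nat | WE of nat | WF4 | WG2.

Definition weyl_valid (T : weyl_type) : bool :=
  match T with
  | WA n => 1 <= n
  | WB n => 2 <= n
  | WD n => 4 <= n
  | WE n => 6 <= n <= 8
  | WF4 | WG2 => true
  end%N.

Definition wrank (T : weyl_type) : nat :=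
  match T with
  | WA n | WB n | WD n | WE n => n
  | WF4 => 4
  | WG2 => 2
  end.

(* Only meaningful for i < j. *)
Definition dynkin_edge (T : weyl_type) (i j : nat) : bool :=
  match T with
  | WD n => if j == n.-1 then i == n - 3 else j == i.+1
  | WE _ => (i, j) \in [:: (0, 2); (1, 3); (2, 3); (3, 4); (4, 5); (5, 6); (6, 7)]
  | _ => j == i.+1
  end%N.

Definition dynkin_adj (T : weyl_type) (i j : nat) : bool :=
  (i != j) && dynkin_edge T (minn i j) (maxn i j).

Definition root_sqlen (T : weyl_type) (i : nat) : nat :=
  match T with
  | WB n => if i == n.-1 then 1 else 2
  | WF4 => if i < 2 then 2 else 1
  | WG2 => if i == 0 then 2 else 6
  | _ => 2
  end%N.

Definition coxeter_m (T : weyl_type) (i j : nat) : nat :=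
  let l := root_sqlen T i in
  let l' := root_sqlen T j in
  if i == j then 1
  else if dynkin_adj T i j then
    match (maxn l l' %/ minn l l')%N with 1 => 3 | 2 => 4 | _ => 6 end
  else 2.

Section Reflection.
Variables (K : numClosedFieldType) (T : weyl_type).

(* h^* is C^n in type A_{n-1}, and the span of the simple roots otherwise. *)
Definition hdim : nat := if T is WA n then n.+1 else wrank T.

Definition simple_root (i : nat) : 'rV[K]_hdim :=
  \row_(k < hdim)
    (if T is WA _ then (k == i :> nat)%:R - (k == i.+1 :> nat)%:R
     else (k == i :> nat)%:R).

(* (alpha_i, alpha_j) : adjacent roots satisfy
   2 (alpha_i, alpha_j) = - max (|alpha_i|^2, |alpha_j|^2). *)
Definition root_gram (i j : nat) : K :=
  if i == j then (root_sqlen T i)%:R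
  else if dynkin_adj T i j then
    - (maxn (root_sqlen T i) (root_sqlen T j))%:R / 2
  else 0.

Definition hform_mx : 'M[K]_hdim :=
  \matrix_(k < hdim, l < hdim)
    (if T is WA _ then (k == l)%:R else root_gram k l).

Definition hform (a b : 'rV[K]_hdim) : K := (a *m hform_mx *m b^T) 0 0.

Definition simple_refl (i : nat) (a : 'rV[K]_hdim) : 'rV[K]_hdim :=
  let r := simple_root i in a - (2 * hform a r / hform r r) *: r.

(* In the Clifford algebra below a^2 = (a, a) / 2, so beta_i^2 = 1. *)
Definition beta (i : nat) : 'rV[K]_hdim :=
  let r := simple_root i in sqrtC (2 / hform r r) *: r.

End Reflection.

Section SpinWeyl.
Variables (K : numClosedFieldType) (T : weyl_type).
Local Notation hdual := ('rV[K]_(hdim T)).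
Local Notation node := ('I_(wrank T)).

Inductive clifford_rel : nc_term K hdual -> nc_term K hdual -> Prop :=
| clifford_relD a b :
    clifford_rel (nc_var (a + b)) (nc_add (nc_var a) (nc_var b))
| clifford_relZ c a :
    clifford_rel (nc_var (c *: a)) (nc_mul (nc_cst c) (nc_var a))
| clifford_relM a b :
    clifford_rel
      (nc_add (nc_mul (nc_var a) (nc_var b)) (nc_mul (nc_var b) (nc_var a)))
      (nc_cst (hform a b)).

Lemma clifford_rel_homog s t : clifford_rel s t ->
  exists d, nc_homog (fun=> true) d s /\ nc_homog (fun=> true) d t.
Proof.
case=> [a b|c a|a b].
- by exists true.
- by exists true; split=> //; exists false.
- by exists false; split=> //; split; exists true.
Qed.

Definition clifford_pres : presentation K := Presentation clifford_rel_homog.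

Definition clifford : superAlgType K := pres_alg clifford_pres.

Definition cl (a : hdual) : clifford := pgen (a : gen clifford_pres).

(* The k for which the Schur multiplier of W is (Z/2)^k. *)
Definition schur_rank : nat :=
  match T with
  | WA n => if n <= 2 then 0 else 1
  | WB n => if n == 2 then 1 else if n == 3 then 2 else 3
  | WD n => if n == 4 then 3 else 2
  | WE _ => 1
  | WF4 => 2
  | WG2 => 1
  end%N.

(* For i < j with m_ij even, alpha_ij is the component of alpha with this
   (0-based) index. *)
Definition cocycle_index (i j : nat) : nat :=
  match T with
  | WA _ | WE _ | WG2 => 0
  | WB n =>
      if n == 2 then 0
      else if n == 3 then (if i == 0 then 0 else 1)
      else if j < n.-1 then 0
      else if i == n - 2 then 2 else 1
  | WD n =>
      if n == 4 then
        (if j == 2 then 0 else if i == 0 then 1 else 2)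
      else if i == n - 2 then 1 else 0
  | WF4 => if (i == 1) && (j == 2) then 1 else 0
  end%N.

Definition cocycle (alpha : schur_rank.-tuple K) (i j : nat) : K :=
  alpha`_(cocycle_index (minn i j) (maxn i j)).

Definition opp_cocycle (alpha : schur_rank.-tuple K) : schur_rank.-tuple K :=
  map_tuple -%R alpha.

Variable alpha : schur_rank.-tuple K.

Inductive twisted_rel : nc_term K node -> nc_term K node -> Prop :=
| twisted_rel_odd (i j : node) : coxeter_m T i j \in [:: 1; 3]%N ->
    twisted_rel (nc_exp (nc_mul (nc_var i) (nc_var j)) (coxeter_m T i j))
      (nc_cst 1)
| twisted_rel_even (i j : node) : coxeter_m T i j \in [:: 2; 4; 6]%N ->
    twisted_rel (nc_exp (nc_mul (nc_var i) (nc_var j)) (coxeter_m T i j))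
      (nc_cst (cocycle alpha i j)).

Lemma twisted_rel_homog p s t : twisted_rel s t ->
  exists d, nc_homog (fun=> p) d s /\ nc_homog (fun=> p) d t.
Proof.
by case=> i j _; exists false; split=> //; apply: (@nc_homog_exp2 _ _ _ p).
Qed.

(* C W^alpha, with even generators. *)
Definition twisted_pres : presentation K :=
  Presentation (@twisted_rel_homog false).

Definition twisted_alg : superAlgType K := pres_alg twisted_pres.

Definition tw (i : node) : twisted_alg := pgen (i : gen twisted_pres).

(* The algebra generated by the Clifford algebra and C W^alpha, with odd
   t_i, subject to the relations t_i a = - s_i(a) t_i. *)
Inductive crossed_rel :
    nc_term K (hdual + node) -> nc_term K (hdual + node) -> Prop :=
| crossed_rel_clifford s t : clifford_rel s t ->
    crossed_rel (nc_map inl s) (nc_map inl t)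
| crossed_rel_twisted s t : twisted_rel s t ->
    crossed_rel (nc_map inr s) (nc_map inr t)
| crossed_rel_cross (i : node) (a : hdual) :
    crossed_rel (nc_mul (nc_var (inr i)) (nc_var (inl a)))
      (nc_opp (nc_mul (nc_var (inl (simple_refl i a))) (nc_var (inr i)))).

Lemma crossed_rel_homog s t : crossed_rel s t ->
  exists d, nc_homog (fun=> true) d s /\ nc_homog (fun=> true) d t.
Proof.
case=> [{}s {}t /clifford_rel_homog|{}s {}t /(twisted_rel_homog true)|i a].
- by move=> [d [hs ht]]; exists d; split; apply: nc_homog_map hs || apply: nc_homog_map ht.
- by move=> [d [hs ht]]; exists d; split; apply: nc_homog_map hs || apply: nc_homog_map ht.
- by exists false; split; [exists true|exists false; split=> //; exists true].
Qed.

Definition crossed_pres : presentation K := Presentation crossed_rel_homog.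

Definition crossed : superAlgType K := pres_alg crossed_pres.

Definition crossed_tw (i : node) : crossed := pgen (inr i : gen crossed_pres).

Definition crossed_cl (x : clifford) : crossed :=
  pmap (inl : gen clifford_pres -> gen crossed_pres) x.

Lemma crossed_cl_gen (a : hdual) :
  crossed_cl (cl a) = pgen (inl a : gen crossed_pres).
Proof.
by apply: (pmap_pgen (P := clifford_pres) (Q := crossed_pres)) => s t r;
  exact: crossed_rel_clifford.
Qed.

Lemma crossed_cl_morphism : superalg_morphism crossed_cl.
Proof.
by apply: (pmap_morphism (P := clifford_pres) (Q := crossed_pres)) => // s t r;
  exact: crossed_rel_clifford.
Qed.

End SpinWeyl.

Arguments tw {K T alpha}.
Arguments crossed_tw {K T alpha}.
Arguments crossed_cl {K T alpha}.

(* Main.v *)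
Require Import Defs.
From mathcomp Require Import all_boot all_order all_algebra.
From mathcomp Require Import reals complex ring zify.

(** Both algebras contain the Clifford algebra Cl, and the theorem says that
    multiplying each generator of the group algebra by beta_i trades elements
    t_i^- that skew-commute with Cl for elements that commute with it.  Since
    algebras given by generators and relations have a universal property, it
    is enough to check relations on generators, and three facts carry them.

    - Because beta_i^2 = 1 and a beta_i + beta_i a = (a, beta_i), conjugation
      by beta_i in Cl is minus the reflection s_i ([cl_reflL], [cl_reflR]).
      Hence beta_i (x) t_i satisfies the cross relation of t_i^-, and
      u_i = beta_i t_i^- commutes with Cl ([even_tw_comm]).

    - The product x = beta_i beta_j has inverse y = beta_j beta_i, and
      x + y = (beta_i, beta_j) is the scalar - 2 cos (pi / m_ij); so x has
      eigenvalues - exp (+- i pi / m_ij), and x ^ m_ij = (-1) ^ (m_ij + 1)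
      ([cl_beta_exp_coxeter]).  This sign is 1 for odd m_ij and -1 for even
      m_ij, which is exactly the change from alpha to - alpha.

    - In Cl (x) C W^alpha the powers of (beta_i (x) t_i)(beta_j (x) t_j)
      split as a tensor, since t_i is even ([phi_gen_coxeter]); on the other
      side u_i u_j equals beta_j beta_i t_i^- t_j^-, whose factors again have
      independent powers ([even_tw_coxeter]).

    So Phi is defined by the presentation of the crossed product.  The map Psi
    comes from the universal property of the graded tensor product
    ([tensor_lift_morphism]): a pair of superalgebra morphisms whose images
    supercommute extends to the tensor product.  The two maps are mutually
    inverse since they are so on generators, again by beta_i^2 = 1. *)

Import Order.TTheory GRing.Theory Num.Theory.
Local Open Scope ring_scope.

Set Implicit Arguments.
Unset Strict Implicit.
Unset Printing Implicit Defensive.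

(** * Morphisms of superalgebras and of presented algebras *)

Section SuperMorphisms.
Variables (K : comPzRingType) (A B : superAlgType K) (f : A -> B).
Hypothesis hf : superalg_morphism f.

Lemma superalg_morphismB x y : f (x - y) = f x - f y.
Proof. by case: hf. Qed.

Lemma superalg_morphism0 : f 0 = 0.
Proof. by rewrite -[in LHS](subrr 0) superalg_morphismB subrr. Qed.

Lemma superalg_morphismN x : f (- x) = - f x.
Proof.
by rewrite -[in LHS](add0r (- x)) superalg_morphismB superalg_morphism0 sub0r.
Qed.

Lemma superalg_morphismD x y : f (x + y) = f x + f y.
Proof. by rewrite -{1}[y]opprK superalg_morphismB superalg_morphismN opprK. Qed.

Lemma superalg_morphism1 : f 1 = 1.
Proof. by case: hf => _ []. Qed.

Lemma superalg_morphismM x y : f (x * y) = f x * f y.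
Proof. by case: hf => _ []. Qed.

Lemma superalg_morphismX x m : f (x ^+ m) = f x ^+ m.
Proof.
elim: m => [|m IHm]; first exact: superalg_morphism1.
by rewrite !exprS superalg_morphismM IHm.
Qed.

Lemma superalg_morphism_algc c : f (algc c) = algc c.
Proof. by case: hf. Qed.

Lemma superalg_morphism_homog d x : spart d x = x -> spart d (f x) = f x.
Proof. by case: hf => _ _ _ hd {2}<-; rewrite hd. Qed.

End SuperMorphisms.

Lemma superalg_morphism_comp (K : comPzRingType) (A B C : superAlgType K)
    (f : A -> B) (g : B -> C) :
  superalg_morphism f -> superalg_morphism g -> superalg_morphism (g \o f).
Proof.
move=> hf hg; split=> [x y|||d x] /=.
- by rewrite (superalg_morphismB hf) (superalg_morphismB hg).
- split=> [|x y] /=; first by rewrite (superalg_morphism1 hf) (superalg_morphism1 hg).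
  by rewrite (superalg_morphismM hf) (superalg_morphismM hg).
- by move=> c /=; rewrite (superalg_morphism_algc hf) (superalg_morphism_algc hg).
- by case: hf hg => _ _ _ -> [_ _ _ ->].
Qed.

Section PresentationTheory.
Variables (K : comPzRingType) (P : presentation K).

Lemma pres_alg_ind (Q : pres_alg P -> Prop) :
  (forall g, Q (pgen g)) -> (forall c, Q (algc c)) ->
  (forall x y, Q x -> Q y -> Q (x + y)) ->
  (forall x y, Q x -> Q y -> Q (x * y)) -> forall x, Q x.
Proof.
move=> Qg Qc QD QM; elim/pcl_ind; elim=> [g|c|s IHs t IHt|s IHs t IHt].
- exact: Qg.
- exact: Qc.
- by rewrite pclD; apply: QD.
- by rewrite pclM; apply: QM.
Qed.

Lemma pres_morphism_ext (B : superAlgType K) (f g : pres_alg P -> B) :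
  superalg_morphism f -> superalg_morphism g ->
  (forall x, f (pgen x) = g (pgen x)) -> f =1 g.
Proof.
move=> hf hg fg; elim/pres_alg_ind=> [//|c|x y IHx IHy|x y IHx IHy].
- by rewrite (superalg_morphism_algc hf) (superalg_morphism_algc hg).
- by rewrite (superalg_morphismD hf) (superalg_morphismD hg) IHx IHy.
- by rewrite (superalg_morphismM hf) (superalg_morphismM hg) IHx IHy.
Qed.

Lemma nc_eval_exp (B : superAlgType K) (f : gen P -> B) t m :
  nc_eval f (nc_exp t m) = nc_eval f t ^+ m.
Proof. by elim: m => [|m IHm] /=; rewrite ?rmorph1 // IHm exprS. Qed.

Lemma nc_eval_pgen t : nc_eval (@pgen K P) t = pcl t.
Proof. by elim: t => //= s -> t ->; rewrite (pclD, pclM). Qed.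

Lemma pgen_rel s t : Defs.grel s t -> nc_eval (@pgen K P) s = nc_eval (@pgen K P) t.
Proof. by move=> r; rewrite !nc_eval_pgen; apply/pclP/nc_rel. Qed.

End PresentationTheory.

Section PresentationMaps.
Variables (K : comPzRingType) (P Q : presentation K) (B : superAlgType K).

Lemma nc_eval_nc_map (h : gen P -> gen Q) (f : gen Q -> B) t :
  nc_eval f (nc_map h t) = nc_eval (P := P) (fun x => f (h x)) t.
Proof. by elim: t => //= s -> t ->. Qed.

Lemma nc_eval_morphism (F : pres_alg P -> B) t : superalg_morphism F ->
  nc_eval (fun x => F (pgen x)) t = F (pcl t).
Proof.
move=> hF; elim: t => [//|c|s IHs t IHt|s IHs t IHt] /=.
- by rewrite -(superalg_morphism_algc hF).
- by rewrite pclD (superalg_morphismD hF) IHs IHt.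
- by rewrite pclM (superalg_morphismM hF) IHs IHt.
Qed.

End PresentationMaps.

(** * The universal property of the graded tensor product *)

Section TensorUniversal.
Variables (K : comPzRingType) (A B : superAlgType K).

Lemma tens_inl_morphism : superalg_morphism (fun a : A => tens a (1 : B)).
Proof.
split=> [x y|||d x]; first by rewrite tensDl tensNl.
- split=> // x y; elim/(@spart_ind _ A): y => [y y' h h'|d y hy].
    by rewrite mulrDr !tensDl h h' mulrDr.
  by rewrite (tensM _ _ (spart1 B) hy) /= !mul1r.
- by [].
- elim/(@spart_ind _ A): x => [x x' h h'|e x hx].
    by rewrite raddfD /= !tensDl h h' raddfD.
  rewrite [RHS](tens_part_homog d hx (spart1 B)) addbF (spart_homog d hx).
  by case: eqP => // _; rewrite tens0l.
Qed.

Lemma tens_inr_morphism : superalg_morphism (fun b : B => tens (1 : A) b).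
Proof.
split=> [x y|||d x].
- by apply: (@addIr _ (tens 1 y)); rewrite -tensDr !subrK.
- split=> // x y; elim/(@spart_ind _ B): x => [x x' h h'|d x hx].
    by rewrite mulrDl !tensDr h h' mulrDl.
  by rewrite (tensM _ _ hx (spart1 A)) andbF /= !mul1r.
- by move=> c; rewrite -[algc c in LHS]mulr1 -tensZ mulr1.
- elim/(@spart_ind _ B): x => [x x' h h'|e x hx].
    by rewrite raddfD /= !tensDr h h' raddfD.
  rewrite [RHS](tens_part_homog d (spart1 A) hx) addFb (spart_homog d hx).
  by case: eqP => // _; rewrite tens0r.
Qed.

Lemma tens_inlM_inr (a : A) (b : B) : tens a 1 * tens 1 b = tens a b.
Proof. by rewrite (tensM _ _ (spart1 B) (spart1 A)) !mul1r mulr1. Qed.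

Variables (C : superAlgType K) (f : A -> C) (g : B -> C).
Hypotheses (hf : superalg_morphism f) (hg : superalg_morphism g).
Hypothesis fg_supercomm : forall d e a b, spart d a = a -> spart e b = b ->
  g b * f a = (-1) ^+ (d && e) * (f a * g b).

Definition tensor_lift : stensor A B -> C := tlift (fun a b => f a * g b).

Lemma tensor_lift_balanced : balanced (fun a b => f a * g b).
Proof.
split=> [a a' b|a b b'|c a b].
- by rewrite (superalg_morphismD hf) mulrDl.
- by rewrite (superalg_morphismD hg) mulrDr.
- rewrite (superalg_morphismM hf) (superalg_morphismM hg).
  rewrite (superalg_morphism_algc hf) (superalg_morphism_algc hg).
  by rewrite algcC -mulrA.
Qed.

Lemma tensor_lift_tens a b : tensor_lift (tens a b) = f a * g b.
Proof. exact: tlift_tens tensor_lift_balanced a b. Qed.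

Lemma tensor_liftD x y : tensor_lift (x + y) = tensor_lift x + tensor_lift y.
Proof. exact: tliftD tensor_lift_balanced x y. Qed.

Lemma tensor_liftB x y : tensor_lift (x - y) = tensor_lift x - tensor_lift y.
Proof. by apply: (@addIr _ (tensor_lift y)); rewrite -tensor_liftD !subrK. Qed.

(** Moving g b past f a' costs the same sign as in the tensor product. *)
Lemma tensor_liftM x y : tensor_lift (x * y) = tensor_lift x * tensor_lift y.
Proof.
elim/tens_homog_ind: x => [x x' h h'|d e a b ha hb].
  by rewrite mulrDl !tensor_liftD h h' mulrDl.
elim/tens_homog_ind: y => [y y' h h'|d' e' a' b' ha' hb'].
  by rewrite mulrDr !tensor_liftD h h' mulrDr.
have signE (k : bool) z : tensor_lift ((-1) ^+ k * z) = (-1) ^+ k * tensor_lift z.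
  case: k; rewrite ?mul1r // !mulN1r -[- z]add0r tensor_liftB.
  by rewrite -{1}(subrr 0) tensor_liftB subrr sub0r.
rewrite (tensM _ _ hb ha') signE !tensor_lift_tens.
rewrite (superalg_morphismM hf) (superalg_morphismM hg).
rewrite -[RHS]mulrA [g b * (_ * _)]mulrA (fg_supercomm ha' hb) andbC.
by case: (d' && e); rewrite !(mul1r, mulN1r, mulNr, mulrN) !mulrA.
Qed.

Lemma tensor_lift_morphism : superalg_morphism tensor_lift.
Proof.
split=> [||c|d x]; first exact: tensor_liftB.
- split; last exact: tensor_liftM.
  rewrite [LHS]tensor_lift_tens (superalg_morphism1 hf).
  by rewrite (superalg_morphism1 hg) mulr1.
- rewrite [LHS]tensor_lift_tens (superalg_morphism_algc hf).
  by rewrite (superalg_morphism1 hg) mulr1.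
- elim/tens_homog_ind: x => [x x' h h'|e e' a b ha hb].
    by rewrite raddfD !tensor_liftD raddfD h h'.
  rewrite [spart d (tens a b)](tens_part_homog d ha hb) tensor_lift_tens.
  have hab := spart_homogM (superalg_morphism_homog hf ha)
    (superalg_morphism_homog hg hb).
  rewrite (spart_homog d hab); case: eqP => _; first exact: tensor_lift_tens.
  by rewrite -(subrr 0) tensor_liftB subrr.
Qed.

End TensorUniversal.

(** No Koszul sign appears because b is even, whatever the parity of a. *)
Lemma tens_evenX (K : comPzRingType) (A B : superAlgType K) (a : A) (b : B) m :
  spart false b = b -> tens a b ^+ m = tens (a ^+ m) (b ^+ m).
Proof.
move=> hb; elim: m => [//|m IHm]; rewrite !exprS IHm.
elim/(@spart_ind _ A): (a ^+ m) => [x y hx hy|d x hx].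
  by rewrite tensDl mulrDr hx hy mulrDr tensDl.
by rewrite (tensM _ _ hb hx) mul1r.
Qed.

(** * Powers of an element determined by its trace *)

(** If x has inverse y and x + y is the scalar c, then x is a root of
    X^2 - c X + 1, and for c = 2 cos theta its eigenvalues are
    exp (+- i theta).  The lemmas below say that x ^ m = 1 or -1 for the angles
    that occur in a Weyl group, for which c or c ^ 2 is an integer. *)

Section PowersFromTrace.
Variables (K : numClosedFieldType) (A : superAlgType K) (x y : A) (c : K).
Hypotheses (xy1 : x * y = 1) (trace_xy : x + y = algc c).

Lemma trace_sqr : x ^+ 2 = algc c * x - 1.
Proof. by rewrite algcC -trace_xy mulrDr xy1 addrK expr2. Qed.

Lemma trace_exp2 : c ^+ 2 = 0 -> x ^+ 2 = -1.
Proof.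
by move/eqP; rewrite sqrf_eq0 trace_sqr => /eqP ->; rewrite raddf0 mul0r sub0r.
Qed.

Lemma trace_exp3 : c = -1 -> x ^+ 3 = 1.
Proof.
move=> hc; have hx : x ^+ 2 = - x - 1.
  by rewrite trace_sqr hc raddfN /= rmorph1 mulN1r.
by rewrite exprSr hx mulrBl mul1r mulNr -expr2 hx opprB opprK addrK.
Qed.

(** The square x ^ 2 has trace c ^ 2 - 2, so this is the characteristic
    equation of x ^ 2. *)
Lemma trace_exp4_of_sqr : x ^+ 4 = algc (c ^+ 2 - 2) * x ^+ 2 - 1.
Proof.
have e : (x ^+ 2 + 1) ^+ 2 = algc (c ^+ 2) * x ^+ 2.
  by rewrite {1}trace_sqr subrK (exprMn_comm _ (algcC c x)) rmorphXn.
rewrite sqrrD1 -exprM in e.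
rewrite raddfB /= mulrBl -e rmorph_nat mulr_natl.
by rewrite [_ + 1 - _]addrAC !addrK.
Qed.

Lemma trace_exp4 : c ^+ 2 = 2 -> x ^+ 4 = -1.
Proof. by rewrite trace_exp4_of_sqr => ->; rewrite subrr raddf0 mul0r sub0r. Qed.

Lemma trace_exp6 : c ^+ 2 = 3 -> x ^+ 6 = -1.
Proof.
move=> hc; have h4 : x ^+ 4 = x ^+ 2 - 1.
  rewrite trace_exp4_of_sqr hc (_ : 3 - 2 = 1) ?rmorph1 ?mul1r //.
  by rewrite -[3]/(2.+1%:R) -natr1 addrC addKr.
(* With z = x ^ 2 the equation is z ^ 2 = z - 1, so z ^ 3 = z ^ 2 - z = -1. *)
by rewrite (exprD x 4 2) h4 mulrBl mul1r -exprD h4 addrC addrA addNr sub0r.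
Qed.

End PowersFromTrace.

(** * Simple roots and the invariant form *)

Section InvariantForm.
Variables (K : numClosedFieldType) (T : weyl_type).
Local Notation form := (@hform K T).

Lemma hformDl (a a' b : 'rV[K]_(hdim T)) : form (a + a') b = form a b + form a' b.
Proof. by rewrite /hform !mulmxDl mxE. Qed.

Lemma hformDr (a b b' : 'rV[K]_(hdim T)) : form a (b + b') = form a b + form a b'.
Proof. by rewrite /hform linearD /= mulmxDr mxE. Qed.

Lemma hformZl c (a b : 'rV[K]_(hdim T)) : form (c *: a) b = c * form a b.
Proof. by rewrite /hform -!scalemxAl mxE. Qed.

Lemma hformZr c (a b : 'rV[K]_(hdim T)) : form a (c *: b) = c * form a b.
Proof. by rewrite /hform linearZ /= -scalemxAr mxE. Qed.

Lemma hform_delta (k l : 'I_(hdim T)) :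
  form (delta_mx 0 k) (delta_mx 0 l) = hform_mx K T k l.
Proof.
by rewrite /hform -rowE trmx_delta -colE !mxE.
Qed.

End InvariantForm.

Section Roots.
Variables (K : numClosedFieldType) (T : weyl_type).
Local Notation root := (simple_root K T).
Local Notation form := (@hform K T).
Local Notation len := (root_sqlen T).
Local Notation bt := (beta K T).

Lemma root_sqlen_gt0 i : (0 < len i)%N.
Proof. by case: T => //= *; case: ifP. Qed.

(** The squared lengths of a fixed type lie in {1, 2} or in {2, 6}. *)
Lemma root_sqlen_ratio i j : exists2 q, q \in [:: 1; 2; 3]%N &
  maxn (len i) (len j) = (q * minn (len i) (len j))%N.
Proof.
by case: T => [n|n|n|n||] /=; try (case: ifP => _); try (case: ifP => _);
  (by exists 1%N) || (by exists 2%N) || (by exists 3%N).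
Qed.

(** In type A the Gram matrix is computed from root i = e_i - e_(i+1) in
    C^(n+1); in the other types it is the matrix of the form by definition. *)
Lemma hform_root (i j : 'I_(wrank T)) : form (root i) (root j) = root_gram K T i j.
Proof.
case: T i j => [n|n|n|n||] i j.
  pose dl (k : 'I_n) : 'I_(hdim (WA n)) := widen_ord (leqnSn n) k.
  pose dr (k : 'I_n) : 'I_(hdim (WA n)) := lift ord0 k.
  have rootE (k : 'I_n) : simple_root K (WA n) k
      = delta_mx 0 (dl k) + (-1) *: delta_mx 0 (dr k).
    by apply/rowP=> l; rewrite !mxE /= mulN1r.
  rewrite !rootE !(hformDl, hformDr, hformZl, hformZr) !hform_delta !mxE /=.
  rewrite -!(inj_eq val_inj) /= /bump !add1n /root_gram /dynkin_adj /= eqSS.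
  rewrite maxnn mulNr divff ?pnatr_eq0 // !mulN1r.
  case: (ltngtP i j) => [lij|lij|->].
  - rewrite (ltn_eqF (leqW lij)) [in RHS]eq_sym.
    by case: eqP => _; rewrite /= !(oppr0, addr0, add0r).
  - rewrite (gtn_eqF (leqW lij)).
    by case: eqP => _; rewrite /= !(oppr0, addr0, add0r).
  - by rewrite (ltn_eqF (leqnn _)) (gtn_eqF (leqnn _)) /= !(oppr0, addr0, add0r) opprK.
all: rewrite [X in hform X _](_ : _ = delta_mx 0 i); last by apply/rowP=> l; rewrite !mxE.
all: rewrite [X in hform _ X](_ : _ = delta_mx 0 j); last by apply/rowP=> l; rewrite !mxE.
all: by rewrite hform_delta mxE.
Qed.

Lemma hform_root_diag (i : 'I_(wrank T)) : form (root i) (root i) = (len i)%:R.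
Proof. by rewrite hform_root /root_gram eqxx. Qed.

Local Notation sc i := (sqrtC (2 / (len i)%:R) : K).

Lemma betaE (i : 'I_(wrank T)) : bt i = sc i *: root i.
Proof. by rewrite /beta hform_root_diag. Qed.

Lemma hform_beta (i j : 'I_(wrank T)) :
  form (bt i) (bt j) = sc i * sc j * root_gram K T i j.
Proof. by rewrite !betaE hformZl hformZr hform_root mulrA. Qed.

Lemma sqlen_neq0 i : (len i)%:R != 0 :> K.
Proof. by rewrite pnatr_eq0 -lt0n root_sqlen_gt0. Qed.

Lemma hform_beta_diag (i : 'I_(wrank T)) : form (bt i) (bt i) = 2.
Proof.
by rewrite hform_beta /root_gram eqxx -expr2 sqrtCK divfK ?sqlen_neq0.
Qed.

(** The square roots in beta cancel: beta_i is normalised so that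
    (beta_i, beta_i) = 2. *)
Lemma simple_reflE (i : 'I_(wrank T)) (a : 'rV[K]_(hdim T)) :
  simple_refl i a = a - form a (bt i) *: bt i.
Proof.
rewrite /simple_refl betaE hformZr scalerA hform_root_diag; congr (_ - _ *: _).
by rewrite [RHS]mulrAC -expr2 sqrtCK mulrAC.
Qed.

(** Adjacent roots have (alpha_i, alpha_j) = - max / 2, whence
    (beta_i, beta_j)^2 = max^2 / (|alpha_i|^2 |alpha_j|^2) = max / min. *)
Lemma hform_beta_adj_sqr (i j : 'I_(wrank T)) q : i != j -> dynkin_adj T i j ->
  maxn (len i) (len j) = (q * minn (len i) (len j))%N ->
  form (bt i) (bt j) ^+ 2 = q%:R.
Proof.
move=> ij adj hq.
have hm : ((len i)%:R * (len j)%:R : K)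
    = (maxn (len i) (len j))%:R * (minn (len i) (len j))%:R.
  by rewrite -!natrM; congr _%:R; case: (leqP (len i) (len j)); rewrite mulnC.
have m0 : (minn (len i) (len j))%:R != 0 :> K.
  by rewrite pnatr_eq0 -lt0n leq_min !root_sqlen_gt0.
rewrite hform_beta /root_gram (negbTE ij : (val i == val j) = false) adj.
rewrite !exprMn !sqrtCK.
have -> : (2 / (len i)%:R) * (2 / (len j)%:R) = 2 * 2 / ((len i)%:R * (len j)%:R) :> K.
  by rewrite mulf_div.
rewrite hm hq natrM.
have q0 : q%:R != 0 :> K.
  apply/eqP => q0; have := root_sqlen_gt0 i.
  have : (len i <= maxn (len i) (len j))%N by rewrite leq_maxl.
  by move/eqP: q0; rewrite hq pnatr_eq0 => /eqP ->; rewrite mul0n leqn0 => /eqP ->.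
move: q%:R (minn _ _)%:R q0 m0 => Q m Q0 m0.
by field; rewrite Q0 m0.
Qed.

(** For m_ij = 3 the square does not suffice: the sign of (beta_i, beta_j)
    decides whether (beta_i beta_j)^3 is 1 or -1. *)
Lemma hform_beta_eq_len (i j : 'I_(wrank T)) : i != j -> dynkin_adj T i j ->
  len i = len j -> form (bt i) (bt j) = -1.
Proof.
move=> ij adj hl.
rewrite hform_beta /root_gram (negbTE ij : (val i == val j) = false) adj.
rewrite hl maxnn -expr2 sqrtCK mulNr mulrN mulrA divfK ?sqlen_neq0 //.
by rewrite divff // pnatr_eq0.
Qed.

End Roots.

(** * Products of the vectors beta in the Clifford algebra *)

Section Clifford.
Variables (K : numClosedFieldType) (T : weyl_type).
Local Notation form := (@hform K T).
Local Notation bt := (beta K T).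
Local Notation Cl := (clifford K T).

Lemma cl_anticomm a b : cl a * cl b + cl b * cl a = algc (form a b) :> Cl.
Proof. exact: (@pgen_rel K (clifford_pres K T) _ _ (clifford_relM a b)). Qed.

Lemma clB a b : cl (a - b) = cl a - cl b :> Cl.
Proof.
apply: (@addIr _ (cl b)); rewrite subrK.
by rewrite -[a in RHS](subrK b); symmetry;
  apply: (@pgen_rel K (clifford_pres K T) _ _ (clifford_relD _ _)).
Qed.

Lemma clZ c a : cl (c *: a) = algc c * cl a :> Cl.
Proof. exact: (@pgen_rel K (clifford_pres K T) _ _ (clifford_relZ c a)). Qed.

Lemma cl_odd a : spart true (cl a) = cl a :> Cl.
Proof. by rewrite spart_pgen. Qed.

Lemma cl_beta_sqr (i : 'I_(wrank T)) : cl (bt i) * cl (bt i) = 1 :> Cl.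
Proof.
have h := cl_anticomm (bt i) (bt i); rewrite hform_beta_diag -mulr2n in h.
have n2 : (2 : K) != 0 by rewrite pnatr_eq0.
(* The Clifford relation only gives 2 beta_i^2 = 2, so one divides by 2. *)
rewrite -[LHS]mul1r -[1 in LHS](rmorph1 (@algc K Cl)) -(mulVf n2) rmorphM.
by rewrite -mulrA rmorph_nat mulr_natl h -rmorphM mulVf // rmorph1.
Qed.

(** Conjugation by beta_i is minus the reflection: with beta_i^2 = 1,
    (a - (a, beta_i) beta_i) beta_i = a beta_i - (a, beta_i) = - beta_i a. *)
Lemma cl_reflL (i : 'I_(wrank T)) a :
  cl (simple_refl i a) * cl (bt i) = - (cl (bt i) * cl a) :> Cl.
Proof.
rewrite simple_reflE clB clZ mulrBl -mulrA cl_beta_sqr mulr1 -cl_anticomm.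
by rewrite opprD addrA subrr sub0r.
Qed.

Lemma cl_reflR (i : 'I_(wrank T)) a :
  cl (bt i) * cl (simple_refl i a) = - (cl a * cl (bt i)) :> Cl.
Proof.
rewrite simple_reflE clB clZ mulrBr mulrA -algcC -mulrA cl_beta_sqr mulr1.
by rewrite -cl_anticomm addrC opprD addrNK.
Qed.

(** The sign that turns alpha into - alpha: the scalar
    beta_i beta_j + beta_j beta_i has square 0, 1, 2, 3 for m_ij = 2, 3, 4, 6,
    and is -1 for m_ij = 3. *)
Lemma cl_beta_exp_coxeter (i j : 'I_(wrank T)) :
  (cl (bt i) * cl (bt j)) ^+ coxeter_m T i j
    = (-1) ^+ (~~ odd (coxeter_m T i j)) :> Cl.
Proof.
rewrite /coxeter_m; case: eqP => [/val_inj ->|/eqP ij].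
  by rewrite cl_beta_sqr.
have ij' : i != j by apply: contraNneq ij => ->.
have xy1 : cl (bt i) * cl (bt j) * (cl (bt j) * cl (bt i)) = 1 :> Cl.
  by rewrite mulrA -(mulrA (cl (bt i))) cl_beta_sqr mulr1 cl_beta_sqr.
have tr := cl_anticomm (bt i) (bt j).
case: ifPn => adj; last first.
  apply: (trace_exp2 xy1 tr).
  by rewrite hform_beta /root_gram (negbTE ij) (negbTE adj) mulr0 expr0n.
have [q q123 hq] := root_sqlen_ratio T i j.
have m_gt0 : (0 < minn (root_sqlen T i) (root_sqlen T j))%N.
  by rewrite leq_min !root_sqlen_gt0.
have hc := hform_beta_adj_sqr K ij' adj hq.
rewrite {1 2}hq mulnK //; move: q123 hc hq; rewrite !inE.
case/or3P=> /eqP-> /= hc hq.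
- apply: (trace_exp3 xy1 tr); apply: hform_beta_eq_len => //.
  by move: hq; rewrite mul1n; lia.
- exact: (trace_exp4 xy1 tr).
- exact: (trace_exp6 xy1 tr).
Qed.

End Clifford.

(** * The defining relations of the two group algebras *)

Section CoxeterRelations.
Variables (K : numClosedFieldType) (T : weyl_type).
Variable alpha : (schur_rank T).-tuple K.

(** With this scalar the odd and the even defining relations of C W^alpha
    become the single relation (t_i t_j) ^ m_ij = twist_scalar i j. *)
Definition twist_scalar (i j : nat) : K :=
  if odd (coxeter_m T i j) then 1 else cocycle alpha i j.

Lemma cocycle_opp i j : cocycle (opp_cocycle alpha) i j = - cocycle alpha i j.
Proof.
rewrite /cocycle /opp_cocycle /=; move: (cocycle_index _ _ _) => k.
have [lk|gk] := ltnP k (size alpha); first by rewrite (nth_map 0).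
by rewrite !nth_default ?size_map // oppr0.
Qed.

Lemma coxeter_m_cases i j :
  (coxeter_m T i j \in [:: 1; 3]%N) || (coxeter_m T i j \in [:: 2; 4; 6]%N).
Proof.
by rewrite /coxeter_m; case: eqP => // _; case: ifP => // _;
  case: (_ %/ _)%N => [|[|[|]]].
Qed.

Lemma twisted_rel_eval (B : superAlgType K) (f : 'I_(wrank T) -> B) :
  (forall i j, (f i * f j) ^+ coxeter_m T i j = algc (twist_scalar i j)) ->
  forall s t, twisted_rel alpha s t ->
    nc_eval (P := twisted_pres alpha) f s = nc_eval (P := twisted_pres alpha) f t.
Proof.
move=> hf _ _ [] i j; rewrite nc_eval_exp /= hf /twist_scalar !inE.
  by case/orP=> /eqP ->; rewrite /= rmorph1.
by case/or3P=> /eqP ->.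
Qed.

Lemma tw_coxeter i j :
  (tw i * tw j) ^+ coxeter_m T i j = algc (twist_scalar i j) :> twisted_alg alpha.
Proof.
have R := @pgen_rel K (twisted_pres alpha).
have /orP[m|m] := coxeter_m_cases i j.
  have := R _ _ (twisted_rel_odd alpha m); rewrite nc_eval_exp => ->.
  by congr algc; move: m; rewrite /twist_scalar !inE => /orP[] /eqP ->.
have := R _ _ (twisted_rel_even alpha m); rewrite nc_eval_exp => ->.
by congr algc; move: m; rewrite /twist_scalar !inE => /or3P[] /eqP ->.
Qed.

Lemma crossed_tw_coxeter i j :
  (crossed_tw i * crossed_tw j) ^+ coxeter_m T i j
    = algc (twist_scalar i j) :> crossed alpha.
Proof.
have R s t (r : twisted_rel alpha s t) :=
  @pgen_rel K (crossed_pres alpha) _ _ (crossed_rel_twisted r).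
have /orP[m|m] := coxeter_m_cases i j.
  have := R _ _ (twisted_rel_odd alpha m).
  rewrite !(nc_eval_nc_map (P := twisted_pres alpha) (Q := crossed_pres alpha)).
  rewrite nc_eval_exp => ->.
  by congr algc; move: m; rewrite /twist_scalar !inE => /orP[] /eqP ->.
have := R _ _ (twisted_rel_even alpha m).
rewrite !(nc_eval_nc_map (P := twisted_pres alpha) (Q := crossed_pres alpha)).
rewrite nc_eval_exp => ->.
by congr algc; move: m; rewrite /twist_scalar !inE => /or3P[] /eqP ->.
Qed.

Lemma tw_even i : spart false (tw i) = tw i :> twisted_alg alpha.
Proof. by rewrite spart_pgen. Qed.

Lemma twisted_alg_even (y : twisted_alg alpha) : spart false y = y.
Proof.
move: y; apply: pres_alg_ind => [i|c|x y hx hy|x y hx hy].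
- exact: tw_even.
- exact: spart_algc1.
- by rewrite raddfD /= hx hy.
- exact: (spart_homogM hx hy).
Qed.

Lemma crossed_tw_odd i : spart true (crossed_tw i) = crossed_tw i :> crossed alpha.
Proof. by rewrite spart_pgen. Qed.

Lemma crossed_tw_cl i a :
  crossed_tw i * crossed_cl (cl a)
    = - (crossed_cl (cl (simple_refl i a)) * crossed_tw i) :> crossed alpha.
Proof.
rewrite !crossed_cl_gen.
rewrite [LHS](@pgen_rel K (crossed_pres alpha) _ _ (crossed_rel_cross alpha i a)) /=.
by rewrite raddfN /= rmorph1 mulN1r.
Qed.

End CoxeterRelations.

(** * The isomorphism *)

Section Isomorphism.
Variables (K : numClosedFieldType) (T : weyl_type).
Variable alpha : (schur_rank T).-tuple K.
Local Notation bt i := (cl (beta K T i)).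
Local Notation Crossed := (crossed (opp_cocycle alpha)).
Local Notation Tensor := (stensor (clifford K T) (twisted_alg alpha)).
Local Notation node := 'I_(wrank T).

Lemma sign_twist_scalar i j :
  (-1) ^+ (~~ odd (coxeter_m T i j)) * twist_scalar alpha i j
    = twist_scalar (opp_cocycle alpha) i j.
Proof.
by rewrite /twist_scalar cocycle_opp; case: odd; rewrite ?mul1r ?mulN1r.
Qed.

Definition phi_gen (g : gen (crossed_pres (opp_cocycle alpha))) : Tensor :=
  match g with inl a => tens (cl a) 1 | inr i => tens (bt i) (tw i) end.

Lemma phi_gen_coxeter (i j : node) :
  (tens (bt i) (tw i) * tens (bt j) (tw j)) ^+ coxeter_m T i j
    = algc (twist_scalar (opp_cocycle alpha) i j) :> Tensor.
Proof.
rewrite (tensM _ _ (tw_even alpha i) (cl_odd _)) mul1r.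
rewrite tens_evenX; last by rewrite twisted_alg_even.
rewrite cl_beta_exp_coxeter tw_coxeter -[algc _ in LHS]mulr1 -tensZ.
rewrite -sign_twist_scalar [RHS]/(tens (algc _) 1) mulrC rmorphM.
by rewrite rmorph_sign.
Qed.

Lemma phi_gen_rel s t : Defs.grel s t -> nc_eval phi_gen s = nc_eval phi_gen t.
Proof.
case=> [{}s {}t r|{}s {}t r|i a].
- rewrite !(nc_eval_nc_map (P := clifford_pres K T)).
  rewrite !(nc_eval_morphism _ (tens_inl_morphism _ _)).
  by congr (tens _ _); apply/pclP/nc_rel.
- rewrite !(nc_eval_nc_map (P := twisted_pres (opp_cocycle alpha))).
  exact: (twisted_rel_eval phi_gen_coxeter).
- rewrite /= raddfN /= rmorph1 mulN1r.
  rewrite (tensM _ _ (tw_even alpha i) (cl_odd _)).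
  rewrite (tensM _ _ (spart1 (twisted_alg alpha)) (cl_odd _)) !mul1r mulr1.
  by rewrite cl_reflL tensNl opprK.
Qed.

Definition Phi : Crossed -> Tensor := plift phi_gen.

Lemma Phi_morphism : superalg_morphism Phi.
Proof.
apply: (plift_morphism phi_gen_rel) => d [a|i].
  exact: (tens_part_homog d (cl_odd a) (spart1 (twisted_alg alpha))).
exact: (tens_part_homog d (cl_odd _) (tw_even alpha i)).
Qed.

Lemma Phi_cl a : Phi (crossed_cl (cl a)) = tens (cl a) 1.
Proof. by rewrite crossed_cl_gen; exact: (plift_pgen phi_gen_rel). Qed.

Lemma Phi_tw i : Phi (crossed_tw i) = tens (bt i) (tw i).
Proof. exact: (plift_pgen phi_gen_rel). Qed.

Lemma Phi_crossed_cl x : Phi (crossed_cl x) = tens x 1.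
Proof.
move: x; apply: pres_morphism_ext; last exact: Phi_cl.
  exact: superalg_morphism_comp (crossed_cl_morphism _) Phi_morphism.
exact: tens_inl_morphism.
Qed.

(** The element u_i = beta_i t_i^-, which will be the image of t_i; it is
    even, being a product of two odd elements. *)
Definition even_tw (i : node) : Crossed := crossed_cl (bt i) * crossed_tw i.

Lemma crossed_cl_beta_sqr (i : node) :
  crossed_cl (bt i) * crossed_cl (bt i) = 1 :> Crossed.
Proof.
have h := crossed_cl_morphism (opp_cocycle alpha).
by rewrite -(superalg_morphismM h) cl_beta_sqr (superalg_morphism1 h).
Qed.

(** Both t_i^- and beta_i move past Cl by minus the reflection s_i, and the
    two effects cancel. *)
Lemma even_tw_comm i x : even_tw i * crossed_cl x = crossed_cl x * even_tw i.
Proof.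
have h := crossed_cl_morphism (opp_cocycle alpha).
move: x; apply: pres_alg_ind => [a|c|x y hx hy|x y hx hy].
- rewrite /even_tw -mulrA crossed_tw_cl mulrN !mulrA -!(superalg_morphismM h).
  by rewrite cl_reflR (superalg_morphismN h) mulNr opprK.
- by rewrite (superalg_morphism_algc h) algcC.
- by rewrite (superalg_morphismD h) mulrDl mulrDr hx hy.
- by rewrite (superalg_morphismM h) mulrA hx -mulrA hy mulrA.
Qed.

(** As u_i u_j commutes with Cl, raising
    t_i^- t_j^- = (beta_i beta_j) (u_i u_j) to the power m_ij raises the two
    factors separately; the sign from the first factor undoes the passage to
    - alpha. *)
Lemma even_tw_coxeter i j :
  (even_tw i * even_tw j) ^+ coxeter_m T i j = algc (twist_scalar alpha i j).
Proof.
have h := crossed_cl_morphism (opp_cocycle alpha).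
have tE : crossed_tw i * crossed_tw j
    = crossed_cl (bt i * bt j) * (even_tw i * even_tw j).
  have -> : even_tw i * even_tw j = crossed_cl (bt j) * even_tw i * crossed_tw j.
    by rewrite -even_tw_comm -mulrA.
  rewrite /even_tw (superalg_morphismM h) !mulrA -(mulrA (crossed_cl (bt i))).
  by rewrite crossed_cl_beta_sqr mulr1 crossed_cl_beta_sqr mul1r.
have := crossed_tw_coxeter (opp_cocycle alpha) i j.
rewrite tE exprMn_comm; last first.
  by rewrite /GRing.comm -[RHS]mulrA even_tw_comm [RHS]mulrA even_tw_comm mulrA.
rewrite -(superalg_morphismX h) cl_beta_exp_coxeter -sign_twist_scalar.
case: (odd _).
  by rewrite /= (superalg_morphism1 h) !mul1r.
rewrite /= (superalg_morphismN h) (superalg_morphism1 h) !mulN1r raddfN.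
exact: oppr_inj.
Qed.

Definition psi_tw : twisted_alg alpha -> Crossed :=
  plift (P := twisted_pres alpha) even_tw.

Lemma psi_tw_morphism : superalg_morphism psi_tw.
Proof.
apply: (@plift_morphism K (twisted_pres alpha) Crossed even_tw
  (twisted_rel_eval even_tw_coxeter)) => d i.
apply: spart_homog.
exact: (spart_homogM (superalg_morphism_homog (crossed_cl_morphism _) (cl_odd _))
  (crossed_tw_odd _ i)).
Qed.

Lemma psi_tw_gen i : psi_tw (tw i) = even_tw i.
Proof. exact: (@plift_pgen K (twisted_pres alpha) Crossed even_tw
  (twisted_rel_eval even_tw_coxeter)). Qed.

Lemma psi_tw_comm x y : psi_tw y * crossed_cl x = crossed_cl x * psi_tw y.
Proof.
have h := psi_tw_morphism.
move: y; apply: pres_alg_ind => [i|c|y z hy hz|y z hy hz].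
- by rewrite psi_tw_gen even_tw_comm.
- by rewrite (superalg_morphism_algc h) algcC.
- by rewrite (superalg_morphismD h) mulrDl mulrDr hy hz.
- by rewrite (superalg_morphismM h) -mulrA hz mulrA hy mulrA.
Qed.

(** No sign is needed because C W^alpha is purely even: an element y of odd
    degree is zero. *)
Lemma psi_tw_supercomm d e (x : clifford K T) (y : twisted_alg alpha) :
  spart d x = x -> spart e y = y ->
  psi_tw y * crossed_cl x = (-1) ^+ (d && e) * (crossed_cl x * psi_tw y).
Proof.
move=> _; case: e => [hy|_]; last by rewrite andbF mul1r psi_tw_comm.
have -> : y = 0 by rewrite -hy (spart_homog true (twisted_alg_even y)).
by rewrite (superalg_morphism0 psi_tw_morphism) !(mulr0, mul0r).
Qed.

Definition Psi : Tensor -> Crossed := tensor_lift crossed_cl psi_tw.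

Let ccl_morphism := crossed_cl_morphism (opp_cocycle alpha).

Lemma Psi_morphism : superalg_morphism Psi.
Proof. exact: tensor_lift_morphism ccl_morphism psi_tw_morphism psi_tw_supercomm. Qed.

Lemma Psi_tens x y : Psi (tens x y) = crossed_cl x * psi_tw y.
Proof. exact: tensor_lift_tens ccl_morphism psi_tw_morphism _ _. Qed.

Lemma PhiK : cancel Phi Psi.
Proof.
apply: pres_morphism_ext (superalg_morphism_comp Phi_morphism Psi_morphism) _ _.
  by split=> // x y.
case=> [a|i] /=.
  rewrite -crossed_cl_gen Phi_cl Psi_tens (superalg_morphism1 psi_tw_morphism).
  exact: mulr1.
rewrite [Phi _]Phi_tw Psi_tens psi_tw_gen /even_tw mulrA crossed_cl_beta_sqr.
exact: mul1r.
Qed.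

Lemma Phi_psi_tw y : Phi (psi_tw y) = tens 1 y.
Proof.
move: y; apply: pres_morphism_ext.
- exact: superalg_morphism_comp psi_tw_morphism Phi_morphism.
- exact: tens_inr_morphism.
- move=> i; rewrite [psi_tw _]psi_tw_gen (superalg_morphismM Phi_morphism).
  rewrite Phi_crossed_cl Phi_tw.
  rewrite (tensM _ _ (spart1 (twisted_alg alpha)) (cl_odd _)) !mul1r.
  by rewrite cl_beta_sqr.
Qed.

Lemma PsiK : cancel Psi Phi.
Proof.
elim/tens_ind=> [x y hx hy|x y].
  by rewrite (superalg_morphismD Psi_morphism) (superalg_morphismD Phi_morphism) hx hy.
rewrite Psi_tens (superalg_morphismM Phi_morphism) Phi_crossed_cl Phi_psi_tw.
exact: tens_inlM_inr.
Qed.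

End Isomorphism.

Theorem theorem2p7 (R : realType) (T : weyl_type) (hT : weyl_valid T)
    (alpha : (schur_rank T).-tuple R[i])
    (halpha : forall a, a \in alpha -> a = 1 \/ a = -1) :
  exists (Phi : crossed (opp_cocycle alpha) ->
                stensor (clifford R[i] T) (twisted_alg alpha))
         (Psi : stensor (clifford R[i] T) (twisted_alg alpha) ->
                crossed (opp_cocycle alpha)),
    [/\ superalg_morphism Phi,
        superalg_morphism Psi,
        cancel Phi Psi /\ cancel Psi Phi,
        (forall x : clifford R[i] T, Phi (crossed_cl x) = tens x 1) /\
        (forall i : 'I_(wrank T),
           Phi (crossed_tw i) = tens (cl (beta R[i] T i)) (tw i))
      & (forall x : clifford R[i] T, Psi (tens x 1) = crossed_cl x) /\
        (forall i : 'I_(wrank T),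
           Psi (tens 1 (tw i)) =
             crossed_cl (cl (beta R[i] T i)) *
             crossed_tw i)].
Proof.
exists (@Phi R[i] T alpha), (@Psi R[i] T alpha); split.
- exact: Phi_morphism.
- exact: Psi_morphism.
- by split; [exact: PhiK | exact: PsiK].
- by split; [exact: Phi_crossed_cl | exact: Phi_tw].
- split=> [x|i].
    by rewrite Psi_tens (superalg_morphism1 (psi_tw_morphism alpha)) mulr1.
  rewrite Psi_tens psi_tw_gen.
  by rewrite (superalg_morphism1 (crossed_cl_morphism _)) mul1r.
Qed.
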